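(* Let $T$ be a tree with root $x_0$ such that $d_x=\max(1,|x|)$ for all $x\in T$. Then $T$ is transient and $$0=h_*=\sqrt{2u_*}.$$
   Context: Trees are locally finite connected graphs without loops, with unit weight on each edge. $|x|$ is the graph distance of $x$ to the root $x_0$; $d_x$ is the number of children of $x$, i.e. of neighbors $y$ of $x$ with $|y|=|x|+1$. Simple random walk $(X_k)_{k\ge0}$ on $T$ started at $x$ has law $P_x$, expectation $E_x$; ${\rm deg}(x)$ is the degree of $x$. For transient $T$, the Green function is $g(x,y)=\frac{1}{{\rm deg}(y)}E_x[\sum_{k\ge0}1\{X_k=y\}]$. Under $\mathbb P^G$, $(\varphi_x)_{x\in T}$ is the Gaussian free field: a centered Gaussian field with covariance $g(\cdot,\cdot)$. $h_*=\inf\{h\in\mathbb R;\ \mathbb P^G\text{-a.s., all connected components of }\{x\in T;\varphi_x\ge h\}\text{ are finite}\}$, $\inf\emptyset=\infty$. For finite $K\subseteq T$, ${\rm cap}(K)=\sum_{x\in K}{\rm deg}(x)P_x[X_k\notin K\text{ for all }k\ge1]$. The vacant set $\mathcal V^u$ of random interlacements at level $u\ge0$ is the random subset of $T$ with law (under $\mathbb P^I$) characterized by $\mathbb P^I[\mathcal V^u\supseteq K]=\exp\{-u\,{\rm cap}(K)\}$ for all finite $K\subseteq T$. $u_*=\inf\{u\ge0;\ \mathbb P^I\text{-a.s., all connected components of }\mathcal V^u\text{ are finite}\}\in[0,\infty]$. *)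

(* Defs.v *)
From HB Require Import structures.
From mathcomp Require Import all_boot all_order all_algebra finmap.
From mathcomp Require Import all_classical all_reals all_analysis.

Set Implicit Arguments.
Unset Strict Implicit.
Unset Printing Implicit Defensive.

Import Order.TTheory GRing.Theory Num.Theory.
Import numFieldNormedType.Exports.

Local Open Scope classical_set_scope.
Local Open Scope ring_scope.

(** A graph is a vertex type [V] with an adjacency relation [E : rel V].
    Connected locally finite graphs are countable, so that taking [V] in
    [choiceType] (with [{fset V}] the type of its finite subsets) loses no
    generality. *)

Definition neighbors (V : choiceType) (E : rel V) (x : V) : set V :=
  [set y | E x y].

Definition is_walk (V : choiceType) (E : rel V) (x y : V) (p : seq V) : Prop :=
  path E x p /\ last x p = y.

Record is_tree (V : choiceType) (E : rel V) : Prop := IsTree {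
  tree_sym : symmetric E ;
  tree_irr : irreflexive E ;
  tree_locally_finite : forall x : V, finite_set (neighbors E x) ;
  tree_connected : forall x y : V, exists p : seq V, is_walk E x y p ;
  tree_acyclic : forall c : seq V, (2 < size c)%N -> ~ ucycle E c
}.

(* [#|` fset_set A|] is the cardinality of [A] when [A] is finite, and the junk
   value 0 otherwise; the two sets below are finite in a tree. *)
Definition deg (V : choiceType) (E : rel V) (x : V) : nat :=
  #|` fset_set (neighbors E x)|.

Definition gdist (V : choiceType) (E : rel V) (x y : V) : nat :=
  get [set n | (exists2 p, is_walk E x y p & size p = n) /\
               (forall p, is_walk E x y p -> (n <= size p)%N)].

Definition nchildren (V : choiceType) (E : rel V) (x0 x : V) : nat :=
  #|` fset_set [set y | E x y /\ gdist E x0 y = (gdist E x0 x).+1]|.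

(* The vertex set of the connected component of [x] in the subgraph induced by
   [A]; meaningful for [x] in [A]. *)
Definition graph_component (V : choiceType) (E : rel V) (A : set V) (x : V) :
    set V :=
  [set y | exists2 p, is_walk E x y p & {in x :: p, forall z, A z}].

Definition all_components_finite (V : choiceType) (E : rel V) (A : set V) :
    Prop :=
  forall x, A x -> finite_set (graph_component E A x).

(* Under [P x], [X] is the simple random walk started at [x]. *)

Definition srw_step (R : realType) (V : choiceType) (E : rel V) (x y : V) : R :=
  if E x y then (deg E x)%:R^-1 else 0.

Record is_srw (R : realType) (V : choiceType) (E : rel V)
    (d : measure_display) (W : measurableType d)
    (P : V -> probability W R) (X : nat -> W -> V) : Prop := IsSrw {
  srw_measurable : forall k y, measurable [set w | X k w = y] ;
  srw_law : forall (x : V) (n : nat) (s : nat -> V),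
    P x [set w | forall k, (k <= n)%N -> X k w = s k] =
    ((s 0%N == x)%:R * \prod_(k < n) srw_step R E (s k) (s k.+1))%:E
}.

Definition transient (R : realType) (V : choiceType)
    (d : measure_display) (W : measurableType d)
    (P : V -> probability W R) (X : nat -> W -> V) : Prop :=
  forall x, (P x [set w | exists2 k, (1 <= k)%N & X k w = x] < 1)%E.

Definition green (R : realType) (V : choiceType) (E : rel V)
    (d : measure_display) (W : measurableType d)
    (P : V -> probability W R) (X : nat -> W -> V) (x y : V) : \bar R :=
  (((deg E y)%:R^-1)%:E *
   \int[P x]_w \sum_(0 <= k <oo) ((X k w == y)%:R)%:E)%E.

Definition cap (R : realType) (V : choiceType) (E : rel V)
    (d : measure_display) (W : measurableType d)
    (P : V -> probability W R) (X : nat -> W -> V) (K : {fset V}) : \bar R :=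
  (\sum_(x <- K)
     ((deg E x)%:R)%:E *
     P x [set w | forall k, (1 <= k)%N -> X k w \notin K])%E.

(* [normal_prob m s] takes the standard deviation [s] as parameter, and it is
   not the Dirac mass at [m] when [s = 0]. *)
Definition is_gaussian (R : realType) (d : measure_display)
    (W : measurableType d) (P : probability W R) (Z : W -> R) : Prop :=
  exists m s : R, 0 <= s /\
    forall A : set R, measurable A ->
      P (Z @^-1` A) = (if s == 0 then \d_m A else normal_prob m s A).

Record is_gff (R : realType) (V : choiceType) (g : V -> V -> \bar R)
    (d : measure_display) (W : measurableType d) (P : probability W R)
    (phi : V -> {RV P >-> R}) : Prop := IsGff {
  gff_gaussian : forall (K : {fset V}) (a : V -> R),
    is_gaussian P (fun w => \sum_(x <- K) a x * phi x w) ;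
  gff_centered : forall x, ('E_P[phi x] = 0)%E ;
  gff_covariance : forall x y, covariance P (phi x) (phi y) = g x y
}.

Definition h_star (R : realType) (V : choiceType) (E : rel V)
    (d : measure_display) (W : measurableType d) (P : probability W R)
    (phi : V -> {RV P >-> R}) : \bar R :=
  ereal_inf [set h%:E | h in [set h : R |
    \forall w \ae P, all_components_finite E [set x | h <= phi x w]]].

(* [U u] is the vacant set at level [u], and [C] stands for the capacity; no
   joint law of the [U u] is prescribed. *)

Record is_vacant_set (R : realType) (V : choiceType) (C : {fset V} -> \bar R)
    (d : measure_display) (W : measurableType d) (P : probability W R)
    (U : R -> W -> set V) : Prop := IsVacantSet {
  vacant_measurable : forall u x, 0 <= u -> measurable [set w | U u w x] ;
  vacant_law : forall u (K : {fset V}), 0 <= u ->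
    P [set w | [set` K] `<=` U u w] = expeR (- (u%:E * C K))%E
}.

Definition u_star (R : realType) (V : choiceType) (E : rel V)
    (d : measure_display) (W : measurableType d) (P : probability W R)
    (U : R -> W -> set V) : \bar R :=
  ereal_inf [set u%:E | u in [set u : R | 0 <= u /\
    \forall w \ae P, all_components_finite E (U u w)]].

(* Main.v *)
Require Import Defs.
From HB Require Import structures.
From mathcomp Require Import all_boot all_order all_algebra finmap.
From mathcomp Require Import all_classical all_reals all_analysis.
From mathcomp Require Import measurable_realfun ring lra zify.

Set Implicit Arguments.
Unset Strict Implicit.
Unset Printing Implicit Defensive.

Import Order.TTheory GRing.Theory Num.Theory.
Import numFieldNormedType.Exports.

Local Open Scope classical_set_scope.
Local Open Scope ring_scope.

(** Write [|x|] for the distance to the root and call child, parent and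
    ancestor of a vertex what these words mean in the rooted tree.  A vertex at
    level [k >= 1] has one parent and [k] children, so that the walk drifts
    away from the root and there are at most [n`!] vertices at level [n].

    Every statement about the walk comes from an explicit superharmonic
    function.  Since the walk at level [k >= 2] steps outwards with probability
    at least 2/3, the function [2 ^- d], where [d] counts the steps down to a
    set of vertices closed under parents and containing levels 0 and 1, is
    superharmonic off that set.  This gives transience ([srw_transient]), the
    estimate [g(x, y) <= 4 * 2 ^- (|x| - |y|) / (|y| + 1)] for [y] other than
    the root, with a truncated difference ([green_bound]), and the lower bound [binomial(N, 2) / 2] for the
    capacity of a vertical path of [N] vertices, all of level at least 2
    ([cap_vpath_ge]).  Bounds on walk probabilities are transferred to the
    given process by summing over finite paths ([pathE_le_srw]).

    An infinite component of a random set [A] contains, for some [m] and every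
    [N], a vertical path of [N] vertices ending at level [m + N].  If such a
    path lies in [A] with probability at most
    [exp (C - c * binomial(N, 2))], with [c > 0], then the expected number of
    these paths is at most [(m + N)`! * exp (C - c * binomial(N, 2))], which
    tends to 0, and all components are almost surely finite
    ([ae_components_finite]).

    - For the vacant set at level [u > 0] the required bound is the capacity
      estimate, whence [u_star_eq0].
    - For the free field at level [h > 0], weight the value at [x] by
      [|x| + 1].  If the field is at least [h] on a vertical path, the weighted
      sum is at least [h * S], where [S] is the sum of the weights, while its
      second moment is at most [24 * S] because the covariances decay
      geometrically along the path ([vpath_second_moment]).  A Gaussian tail
      bound then gives [exp (1 - h ^ 2 * S / 2304)], and [S] is at least
      [binomial(N, 2)] ([gff_vpath_ge_le]).
    - For [h < 0] the variance at level [k] is at most [4 / (k + 1)], so the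
      probabilities that the field is below [h] are summable along a ray, and a
      tail of the ray stays above [h] with positive probability
      ([gff_neg_level_infinite]). *)

(** * The rooted tree *)

Section Transition.
Variables (V : choiceType) (E : rel V) (R : realType).
Implicit Type f : V -> R.

(** The neighbors of [x]; this finite set is correct when [neighbors E x] is
    finite. *)
Definition nbrs (x : V) : {fset V} := fset_set (neighbors E x).

(** The transition operator of the simple random walk. *)
Definition avg f (x : V) : R := (deg E x)%:R^-1 * \sum_(z <- nbrs x) f z.

Lemma ler_avg f g x : (forall z, f z <= g z) -> avg f x <= avg g x.
Proof.
by move=> fg; rewrite /avg ler_wpM2l ?invr_ge0 // ler_sum.
Qed.

Lemma avg_cst c x : (0 < deg E x)%N -> avg (fun=> c) x = c.
Proof.
move=> dx; rewrite /avg big_const_seq count_predT iter_addr_0 -[size _]/(deg E x).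
by rewrite -(mulr_natl c) mulKf // pnatr_eq0 -lt0n dx.
Qed.

Lemma avgB f g x : avg (fun z => f z - g z) x = avg f x - avg g x.
Proof. by rewrite /avg sumrB mulrBr. Qed.

End Transition.

Section Tree.
Variables (V : choiceType) (E : rel V) (x0 : V).
Hypothesis htree : is_tree E.

Local Notation lev := (gdist E x0).
Local Notation nbrs := (nbrs E).

Lemma gdist_spec x :
  (exists2 p, is_walk E x0 x p & size p = lev x) /\
  (forall p, is_walk E x0 x p -> (lev x <= size p)%N).
Proof.
rewrite /gdist.
set A := [set n | _].
suff: A (get A) by [].
apply: getPex.
have [p0 hp0] := tree_connected htree x0 x.
have exP : exists n, `[< exists2 p, is_walk E x0 x p & size p = n >].
  by exists (size p0); apply/asboolP; exists p0.
exists (ex_minn exP).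
case: ex_minnP => n /asboolP hn hmin; split => // p hp.
by apply: hmin; apply/asboolP; exists p.
Qed.

Lemma lev_walk x p : is_walk E x0 x p -> (lev x <= size p)%N.
Proof. by case: (gdist_spec x) => _; apply. Qed.

Lemma lev_root : lev x0 = 0%N.
Proof. by apply/eqP; rewrite -leqn0; apply: (@lev_walk x0 [::]). Qed.

Lemma lev0 x : lev x = 0%N -> x = x0.
Proof. by case: (gdist_spec x) => -[[|y p] [_ <-]] // <-. Qed.

Lemma lev_adj x y : E x y -> (lev y <= (lev x).+1)%N.
Proof.
move=> xy; have [[p [hp lp] <-] _] := gdist_spec x.
rewrite -(size_rcons p y); apply: lev_walk.
by split; rewrite ?last_rcons // rcons_path hp lp.
Qed.

Lemma par_exists x : x != x0 -> exists y, E x y /\ lev x = (lev y).+1.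
Proof.
move=> xx0; have [[p [hp lp] sp] _] := gdist_spec x.
case/lastP: p => [|p z] in hp lp sp *; first by rewrite -lp eqxx in xx0.
move: lp hp sp; rewrite last_rcons rcons_path size_rcons => -> /andP[hp hx] sp.
exists (last x0 p); split; first by rewrite (tree_sym htree).
have /lev_adj h := hx.
have : (lev (last x0 p) <= size p)%N by apply: lev_walk.
by move: sp h; lia.
Qed.

(** The parent of a vertex; the root is its own parent. *)
Definition par (x : V) : V :=
  xget x0 [set y | E x y /\ lev x = (lev y).+1].

Lemma parP x : x != x0 -> E x (par x) /\ lev x = (lev (par x)).+1.
Proof.
move=> /par_exists; rewrite /par; set A := [set y | _] => hA.
by suff: A (xget x0 A) by []; apply: xgetPex.
Qed.

Lemma par_root : par x0 = x0.
Proof.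
by rewrite /par; case: xgetP => // y _ [_]; rewrite lev_root.
Qed.

Lemma lev_par x : lev (par x) = (lev x).-1.
Proof.
have [->|/parP[_ ->]//] := eqVneq x x0.
by rewrite par_root lev_root.
Qed.

Lemma lev_iter_par i x : lev (iter i par x) = (lev x - i)%N.
Proof. by elim: i => [|i IH] /=; rewrite ?subn0 // lev_par IH subnS. Qed.

Lemma lev_gt0 x : (0 < lev x)%N = (x != x0).
Proof.
have [->|xx0] := eqVneq x x0; first by rewrite lev_root.
by rewrite lt0n; apply: contra_neq xx0; exact: lev0.
Qed.

(** The walk that follows the parents from [y] leaves the level of [y] at its
   first step, and meets no other vertex of that level or of a higher one. *)
Lemma walk_to_root_avoiding x y : (lev y <= lev x)%N -> y != x ->
  exists p, [/\ path E y p, last y p = x0 & x \notin y :: p].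
Proof.
move En : (lev y) => n; elim: n y En => [|n IH] y En le_yx yx.
  by exists [::]; rewrite /= mem_seq1 eq_sym yx; split => //; exact: lev0.
have y0 : y != x0 by rewrite -lev_gt0 En.
have [Eyp lyp] := parP y0.
have [|||p [hp lp xp]] := IH (par y).
- by move: lyp; rewrite En => -[].
- exact: ltnW.
- apply: contraTneq le_yx => <-; rewrite -ltnNge.
  by move: lyp; rewrite En => -[->].
exists (par y :: p) => /=; rewrite Eyp hp lp; split => //.
by rewrite inE negb_or eq_sym yx.
Qed.

(** Two distinct such neighbors would be joined through the root by a walk that
   avoids [x], and would close a cycle through [x]. *)
Lemma lower_neighbor_unique x y1 y2 : E x y1 -> E x y2 ->
  (lev y1 <= lev x)%N -> (lev y2 <= lev x)%N -> y1 = y2.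
Proof.
move=> xy1 xy2 l1 l2; apply/eqP; apply/negPn/negP => y12.
have ne z : E x z -> z != x.
  by move=> xz; apply: contraTneq xz => ->; rewrite (tree_irr htree).
have [p1 [hp1 lp1 xp1]] := walk_to_root_avoiding l1 (ne _ xy1).
have [p2 [hp2 lp2 xp2]] := walk_to_root_avoiding l2 (ne _ xy2).
pose q := p1 ++ rev (belast y2 p2).
have hq : path E y1 q.
  rewrite cat_path hp1 lp1 -lp2 rev_path /=.
  by under eq_path => u v do rewrite (tree_sym htree).
have lq : last y1 q = y2.
  rewrite last_cat lp1; case: (p2) lp2 => [|z p] //= _.
  by rewrite rev_cons last_rcons.
have xq : x \notin y1 :: q.
  rewrite -cat_cons mem_cat negb_or xp1 mem_rev.
  by apply: contra xp2; exact: mem_belast.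
have := lq; case/shortenP: hq => p' hp' up' sub lp'.
have xp' : x \notin y1 :: p'.
  apply: contra xq; rewrite !inE => /orP[->//|/sub ->].
  by rewrite orbT.
apply: (tree_acyclic htree (c := x :: y1 :: p')).
  case: p' {hp' up' sub xp'} lp' => [|//] /= h.
  by rewrite h eqxx in y12.
rewrite /ucycle /cycle rcons_path [last _ _]/= lp' [path _ _ _]/= xy1 hp'.
rewrite (tree_sym htree) xy2 andbT.
by move: xp' up'; rewrite !cons_uniq => -> ->.
Qed.

Lemma adj_root_neq x y : E x y -> (lev y <= lev x)%N -> x != x0.
Proof.
move=> xy; apply: contraTneq => xE; rewrite -ltnNge xE lev_root lev_gt0.
by apply: contraTneq xy => ->; rewrite xE (tree_irr htree).
Qed.

Lemma adj_par x y : E x y -> (lev y <= lev x)%N -> y = par x.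
Proof.
move=> xy yx; have [Exp lxp] := parP (adj_root_neq xy yx).
by apply: lower_neighbor_unique Exp yx _ => //; rewrite lxp.
Qed.

Lemma adj_child x y : E x y -> lev y = (lev x).+1 -> par y = x.
Proof.
move=> xy yx; apply/esym/adj_par; first by rewrite (tree_sym htree).
by rewrite yx.
Qed.

Lemma adj_cases x y : E x y ->
  (x != x0 /\ y = par x) \/ (lev y = (lev x).+1 /\ par y = x).
Proof.
move=> xy; case: (leqP (lev y) (lev x)) => h.
  by left; split; [exact: adj_root_neq xy h | exact: adj_par].
have h' : lev y = (lev x).+1 by apply/eqP; rewrite eqn_leq h lev_adj.
by right; split=> //; exact: adj_child.
Qed.

(** The neighbors of [x] that are one step further from the root. *)
Definition children (x : V) : {fset V} :=
  fset_set [set y | E x y /\ lev y = (lev x).+1].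

Lemma in_nbrs x y : (y \in nbrs x) = E x y.
Proof.
rewrite in_fset_set; last exact: tree_locally_finite.
by apply/idP/idP; rewrite inE.
Qed.

Lemma in_children x y : (y \in children x) = E x y && (lev y == (lev x).+1).
Proof.
rewrite in_fset_set; last first.
  by apply: sub_finite_set (tree_locally_finite htree x) => z [].
apply/idP/idP; rewrite inE /=; first by case=> -> ->; rewrite eqxx.
by case/andP=> -> /eqP ->.
Qed.

Lemma childP x y : y \in children x -> par y = x /\ lev y = (lev x).+1.
Proof.
by rewrite in_children => /andP[xy /eqP l]; split=> //; exact: adj_child.
Qed.

Lemma nbrs_root : nbrs x0 = children x0.
Proof.
apply/fsetP => y; rewrite in_nbrs in_children.
case xy: (E x0 y) => //=.
have [[]|[-> _]] := adj_cases xy; last by rewrite eqxx.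
by rewrite eqxx.
Qed.

Lemma nbrsE x : x != x0 -> nbrs x = (par x |` children x)%fset.
Proof.
move=> xx0; have [Exp lxp] := parP xx0.
apply/fsetP => y; rewrite in_fset1U in_nbrs in_children.
have [->|yp] /= := eqVneq y (par x); first by rewrite Exp.
case xy: (E x y) => //=.
have [[_ yE]|[-> _]] := adj_cases xy; last by rewrite eqxx.
by rewrite yE eqxx in yp.
Qed.

Lemma par_notin_children x : par x \notin children x.
Proof.
apply/negP => /childP[_]; rewrite lev_par => h.
by move: h; lia.
Qed.

Section Sum.
Variables (R : realType) (f : V -> R).

Lemma sum_nbrs_root : \sum_(z <- nbrs x0) f z = \sum_(z <- children x0) f z.
Proof. by rewrite nbrs_root. Qed.

Lemma sum_nbrs x : x != x0 ->
  \sum_(z <- nbrs x) f z = f (par x) + \sum_(z <- children x) f z.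
Proof.
move=> /nbrsE ->.
by rewrite big_fsetU1 //= par_notin_children.
Qed.

End Sum.

Hypothesis hchildren : forall x, nchildren E x0 x = maxn 1 (lev x).

Lemma card_children x : #|` children x| = maxn 1 (lev x).
Proof. exact: hchildren. Qed.

Lemma deg_root : deg E x0 = 1%N.
Proof. by rewrite /deg -/(nbrs x0) nbrs_root card_children lev_root. Qed.

Lemma degE x : x != x0 -> deg E x = (lev x).+1.
Proof.
move=> xx0; rewrite /deg -/(nbrs x) nbrsE // cardfsU1 par_notin_children.
rewrite card_children; move: xx0; rewrite -lev_gt0; lia.
Qed.

Lemma deg_gt0 x : (0 < deg E x)%N.
Proof. by have [->|/degE->//] := eqVneq x x0; rewrite deg_root. Qed.

Lemma child_exists x : exists y, y \in children x.
Proof.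
have : (0 < #|` children x|)%N by rewrite card_children leq_max.
by rewrite cardfs_gt0 => /fset0Pn[y]; exists y.
Qed.

(** The vertices at distance [n] from the root, listed generation by
    generation. *)
Fixpoint sphere (n : nat) : seq V :=
  if n is n'.+1 then flatten [seq (children x : seq V) | x <- sphere n']
  else [:: x0].

Lemma mem_sphere x : x \in sphere (lev x).
Proof.
move En: (lev x) => n; elim: n x En => [|n IH] x En.
  by rewrite /= mem_seq1; apply/eqP/lev0.
have xx0 : x != x0 by rewrite -lev_gt0 En.
have [Exp lxp] := parP xx0.
apply/flattenP; exists (children (par x) : seq V).
  by apply: map_f; apply: IH; rewrite lev_par En.
by rewrite in_children (tree_sym htree) Exp /= lxp.
Qed.

Lemma lev_sphere n x : x \in sphere n -> lev x = n.
Proof.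
elim: n x => [|n IH] x /=; first by rewrite mem_seq1 => /eqP ->; exact: lev_root.
by case/flattenP => s /mapP[y /IH <- ->] /childP[].
Qed.

Lemma size_sphere n : (size (sphere n) <= n`!)%N.
Proof.
elim: n => // n IH; rewrite /= size_flatten /shape -map_comp sumnE big_map.
rewrite big_seq (eq_bigr (fun=> maxn 1 n)) => [|x xn].
  rewrite -big_seq big_const_seq count_predT iter_addn_0 factS.
  by rewrite leq_mul //; lia.
by rewrite -[LHS]/(#|` children x|) card_children (lev_sphere xn).
Qed.

Section Average.
Variable R : realType.
Implicit Type f : V -> R.
Local Notation avg := (@avg V E R).

Lemma sum_children_le f x b : (forall y, y \in children x -> f y <= b) ->
  \sum_(z <- children x) f z <= (maxn 1 (lev x))%:R * b.
Proof.
move=> h; rewrite -card_children.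
apply: (@le_trans _ _ (\sum_(z <- children x) b)).
  by rewrite !big_seq; exact: ler_sum.
by rewrite big_const_seq count_predT iter_addr_0 mulr_natl.
Qed.

Lemma avg_root_le f b : (forall y, y \in children x0 -> f y <= b) ->
  avg f x0 <= b.
Proof.
move=> h; rewrite /avg deg_root invr1 mul1r sum_nbrs_root.
by apply: le_trans (sum_children_le h) _; rewrite lev_root mul1r.
Qed.

Lemma avg_le f x a b : x != x0 -> f (par x) <= a ->
  (forall y, y \in children x -> f y <= b) ->
  avg f x <= (a + (lev x)%:R * b) / (lev x).+1%:R.
Proof.
move=> xx0 ha hb; rewrite /avg degE // mulrC ler_wpM2r ?invr_ge0 //.
rewrite sum_nbrs // lerD //; apply: le_trans (sum_children_le hb) _.
by rewrite (maxn_idPr _) // lev_gt0.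
Qed.

(** One parent of value [2 * c] and [k >= 2] children of value [c / 2]. *)
Lemma halving_superharmonic (c : R) (k : nat) : (1 < k)%N -> 0 <= c ->
  (2 * c + k%:R * (c / 2)) / k.+1%:R <= c.
Proof.
move=> k2 c0; rewrite ler_pdivrMr ?ltr0n //.
have k2' : 0 <= k%:R - 2 :> R by rewrite subr_ge0 (ler_nat R 2).
have := mulr_ge0 c0 k2'; rewrite -[k.+1%:R]natr1; nra.
Qed.

End Average.
End Tree.

(** * Path expectations of the simple random walk *)

Section MeasureFacts.
Variables (R : realType) (d : measure_display) (W : measurableType d).
Variable P : probability W R.

Lemma probability_bigcap_ge (F : (set W)^nat) (c : \bar R) :
  (forall n, measurable (F n)) -> nonincreasing_seq F ->
  (forall n, c <= P (F n))%E -> (c <= P (\bigcap_n F n))%E.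
Proof.
move=> mF niF cF.
have mcap : measurable (\bigcap_n F n) by exact: bigcapT_measurable.
have cvgP : P \o F @ \oo --> P (\bigcap_n F n).
  apply: nonincreasing_cvg_mu => //.
  by rewrite (le_lt_trans (probability_le1 P (mF 0%N))) // ltry.
rewrite -(cvg_lim _ cvgP) //; apply: lime_ge.
  by apply/cvg_ex; exists (P (\bigcap_n F n)).
by apply: nearW.
Qed.

(** Decomposition of [A] according to the value of [Y], restricted to finitely
   many values: [Y] need not have countable range. *)
Lemma probability_sum_fiber_le (V : eqType) (Y : W -> V) (A : set W) (s : seq V) :
  (forall z, measurable [set w | Y w = z]) -> measurable A -> uniq s ->
  (\sum_(z <- s) P (A `&` [set w | Y w = z]) <= P A)%E.
Proof.
move=> mY mA us.
have mfib B z : measurable B -> measurable (B `&` [set w | Y w = z]).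
  by move=> mB; exact: measurableI.
elim: s A mA us => [|z s IH] A mA; first by rewrite big_nil.
rewrite cons_uniq big_cons => /andP[zs us].
rewrite -[A in X in (_ <= X)%E](setUIDK A [set w | Y w = z]) measureU; last first.
- by rewrite setDE setIACA setICr setI0.
- exact: measurableD.
- exact: mfib.
rewrite leeD2l //.
apply: le_trans (IH (A `\` [set w | Y w = z]) _ us); last exact: measurableD.
rewrite big_seq [X in (_ <= X)%E]big_seq.
apply: lee_sum => y ys; rewrite le_measure ?inE //.
- exact: mfib.
- by apply: mfib; exact: measurableD.
move=> w /= [Aw yw]; split=> //; split=> // zw.
by move: zs; rewrite -zw yw ys.
Qed.

End MeasureFacts.

Section Walk.
Variables (R : realType) (V : choiceType) (E : rel V).
Hypothesis htree : is_tree E.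
Hypothesis deg_gt0 : forall x, (0 < deg E x)%N.

Local Notation avg := (@avg V E R).

(** [pathE n x F] is the expectation of [F] at the first [n.+1] positions of
    the simple random walk started at [x], computed by summing over paths. *)
Fixpoint pathE (n : nat) (x : V) (F : seq V -> R) : R :=
  if n is n'.+1 then avg (fun z => pathE n' z (F \o cons x)) x else F [:: x].

Variables (dX : measure_display) (OX : measurableType dX).
Variables (PX : V -> probability OX R) (X : nat -> OX -> V).
Hypothesis hX : is_srw E PX X.

Lemma measurable_srw_eq k y : measurable [set w | X k w = y].
Proof. exact: srw_measurable hX k y. Qed.

Lemma measurable_srw_cyl n (s : nat -> V) :
  measurable [set w | forall k, (k <= n)%N -> X k w = s k].
Proof.
rewrite (_ : [set w | _] =
  \bigcap_(k in [set k | (k <= n)%N]) [set w | X k w = s k]) //.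
by apply: bigcap_measurableType => k _; exact: measurable_srw_eq.
Qed.

(** Only one inequality is needed, since it also applies to complements. It asks
   of [D] merely to contain the event that [F] describes, so that no
   measurability of the latter is required. *)
Lemma pathE_le_srw_cond n j (s : nat -> V) x (F : pred (seq V)) (D : set OX) :
  measurable D ->
  (forall w, (forall k, (k <= j)%N -> X k w = s k) ->
     F [seq X k w | k <- iota j n.+1] -> D w) ->
  (((s 0%N == x)%:R * \prod_(k < j) srw_step R E (s k) (s k.+1) *
     pathE n (s j) (fun p => (F p)%:R))%:E
   <= PX x ([set w | forall k, (k <= j)%N -> X k w = s k] `&` D))%E.
Proof.
elim: n j s F => [|n IH] j s F mD FD.
  rewrite /=; case Fs : (F [:: s j]); last by rewrite mulr0.
  rewrite mulr1 (_ : _ `&` D = [set w | forall k, (k <= j)%N -> X k w = s k]).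
    by rewrite (srw_law hX).
  rewrite setIidPl => w hw; apply: FD => //=.
  by rewrite hw.
set C := [set w | _].
have mC : measurable C by exact: measurable_srw_cyl.
have mCD : measurable (C `&` D) by exact: measurableI.
apply: le_trans (probability_sum_fiber_le (PX x) (measurable_srw_eq j.+1) mCD
  (fset_uniq (nbrs E (s j)))).
rewrite /= /avg mulrA mulr_sumr -sumEFin big_seq [leRHS]big_seq.
apply: lee_sum => z zs.
pose s' k := if (k <= j)%N then s k else z.
have Xs' w : (forall k, (k <= j.+1)%N -> X k w = s' k) <->
    C w /\ X j.+1 w = z.
  split=> [h|[h1 h2] k].
    split; last by rewrite h // /s' ltnn.
    by move=> k kj; rewrite h ?(leqW kj) // /s' kj.
  rewrite leq_eqVlt ltnS => /orP[/eqP ->|kj]; first by rewrite /s' ltnn.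
  by rewrite /s' kj h1.
have h := IH j.+1 s' (F \o cons (s j)) mD.
have eC : [set w | forall k, (k <= j.+1)%N -> X k w = s' k] `&` D =
          C `&` D `&` [set w | X j.+1 w = z].
  apply/seteqP; split=> w /=.
    by case=> /Xs'[? ?] ?.
  by case=> -[? ?] ?; split=> //; apply/Xs'.
rewrite eC in h; apply: le_trans (h _); last first.
  by move=> w /Xs'[Cw Xz] Fw; apply: FD => //=; rewrite Cw.
have s'z : s' j.+1 = z by rewrite /s' ltnn.
have s'j : s' j = s j by rewrite /s' leqnn.
rewrite big_ord_recr /= s'z s'j (_ : s' 0%N = s 0%N) //.
rewrite (_ : \prod_(i < j) srw_step R E (s' i) (s' i.+1) =
             \prod_(i < j) srw_step R E (s i) (s i.+1)); last first.
  by apply: eq_bigr => k _; rewrite /s' (ltnW (ltn_ord k)) ltn_ord.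
rewrite lee_fin /srw_step -(in_nbrs htree) zs.
by rewrite !mulrA.
Qed.

Lemma pathE_le_srw n x (F : pred (seq V)) (D : set OX) : measurable D ->
  (forall w, X 0%N w = x -> F [seq X k w | k <- iota 0 n.+1] -> D w) ->
  ((pathE n x (fun p => (F p)%:R))%:E <= PX x D)%E.
Proof.
move=> mD FD.
have := @pathE_le_srw_cond n 0 (fun=> x) x F D mD.
rewrite eqxx big_ord0 !mul1r => h; apply: le_trans (h _) _.
  by move=> w /(_ 0%N isT); exact: FD.
rewrite le_measure ?inE //.
by apply: measurableI => //; exact: measurable_srw_cyl.
Qed.

(** * Hitting probabilities *)

Lemma ler_pathE n x (F G : seq V -> R) : (forall p, F p <= G p) ->
  pathE n x F <= pathE n x G.
Proof.
elim: n x F G => [|n IH] x F G FG /=; first exact: FG.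
by apply: ler_avg => z; apply: IH => p; exact: FG.
Qed.

Lemma pathE0 n x : pathE n x (fun=> 0) = 0.
Proof.
elim: n x => //= n IH x.
by rewrite /avg big1 ?mulr0 // => z _; exact: IH.
Qed.

(** Optional stopping: a nonnegative function that is superharmonic off [A] and
   at least 1 on [A] dominates the probability of hitting [A]. *)
Lemma pathE_avoid_ge (A : pred V) (f : V -> R) n x :
  (forall z, 0 <= f z) -> (forall z, A z -> 1 <= f z) ->
  (forall z, ~~ A z -> avg f z <= f z) ->
  1 - f x <= pathE n x (fun p => (~~ has A p)%:R).
Proof.
move=> f0 fA fsup; elim: n x => [|n IH] x /=.
  rewrite orbF; case: (boolP (A x)) => Ax /=.
    by rewrite subr_le0 fA.
  by rewrite lerBlDr lerDl f0.
case: (boolP (A x)) => Ax.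
  apply: (@le_trans _ _ 0); first by rewrite subr_le0 fA.
  rewrite -(pathE0 n.+1 x) /=; apply: ler_avg => z; apply: ler_pathE => p /=.
  by rewrite Ax.
apply: (@le_trans _ _ (avg (fun z => 1 - f z) x)).
  by rewrite avgB avg_cst // lerB // fsup.
apply: ler_avg => z; apply: le_trans (IH z) _; apply: ler_pathE => p /=.
by rewrite (negPf Ax).
Qed.

Lemma srw_avoid_ge (K : {fset V}) (f : V -> R) x :
  (forall z, 0 <= f z) -> (forall z, z \in K -> 1 <= f z) ->
  (forall z, z \notin K -> avg f z <= f z) ->
  ((1 - avg f x)%:E <=
    PX x [set w | forall k, (1 <= k)%N -> X k w \notin K])%E.
Proof.
move=> f0 fK fsup.
pose F n := [set w | forall k, (1 <= k <= n)%N -> X k w \notin K].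
have -> : [set w | forall k, (1 <= k)%N -> X k w \notin K] = \bigcap_n F n.
  apply/seteqP; split=> w /=.
    by move=> h n _ k /andP[k1 _]; exact: h.
  by move=> h k k1; apply: (h k) => //; rewrite k1 leqnn.
have mnK k : measurable [set w | X k w \notin K].
  rewrite (_ : [set w | _] = ~` \bigcup_(y in [set` K]) [set w | X k w = y]).
    apply: measurableC; apply: fin_bigcup_measurable => // y _.
    exact: measurable_srw_eq.
  apply/seteqP; split=> w /=.
    by move=> /negP h [y yK yw]; apply: h; rewrite yw.
  by move=> h; apply/negP => wK; apply: h; exists (X k w).
have mF n : measurable (F n).
  rewrite (_ : F n = \bigcap_(k in [set k | (1 <= k <= n)%N])
                       [set w | X k w \notin K]) //.
  by apply: bigcap_measurableType.
have niF : nonincreasing_seq F.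
  move=> m n mn; apply/subsetPset => w h k /andP[k1 km].
  by apply: h; rewrite k1 (leq_trans km).
apply: (probability_bigcap_ge mF niF) => n.
have h := @pathE_le_srw n.+1 x (fun p => ~~ has (mem K) (behead p)) (F n) (mF n).
apply: le_trans (h _); last first.
  move=> w _ /hasPn hK k /andP[k1 kn]; apply: hK.
  by apply: (map_f (fun i => X i w) (s := iota 1 n.+1)); rewrite mem_iota; lia.
rewrite lee_fin /=.
apply: (@le_trans _ _ (avg (fun z => 1 - f z) x)); first by rewrite avgB avg_cst.
apply: ler_avg => z.
by have := @pathE_avoid_ge (mem K) f n z f0 fK fsup.
Qed.

(** * Green function *)

Lemma srw_at_le k x y :
  (PX x [set w | X k w = y] <= (iter k avg (fun z => (z == y)%:R) x)%:E)%E.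
Proof.
have mk := measurable_srw_eq k y.
have hq c : pathE k x (fun p => (last c p != y)%:R) =
           1 - iter k avg (fun z => (z == y)%:R) x.
  elim: (k) (x) c => [|n IH] z c /=; first by case: eqP => _ /=; lra.
  rewrite -[X in X - _](avg_cst 1 (deg_gt0 z)) -avgB.
  congr (_ * _); apply: eq_bigr => u _; exact: (IH u z).
have h : ((1 - iter k avg (fun z => (z == y)%:R) x)%:E <=
   PX x (~` [set w | X k w = y]))%E.
  rewrite -(hq x); apply: (@pathE_le_srw _ _ (fun p => last x p != y)).
    exact: measurableC.
  move=> w _; rewrite -[k.+1]addn1 iotaD map_cat last_cat /= => /eqP.
  by rewrite add0n.
move: h; rewrite probability_setC // EFinB.
rewrite -(fineK (fin_num_measure (PX x) _ mk)) -!EFinB !lee_fin; lra.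
Qed.

(** A supersolution of the Poisson equation bounds the expected number of
   visits. *)
Lemma sum_iter_avg_le (f : V -> R) y N x : (forall z, 0 <= f z) ->
  (forall z, (z == y)%:R + avg f z <= f z) ->
  \sum_(k < N) iter k avg (fun z => (z == y)%:R) x <= f x.
Proof.
move=> f0 fsup; elim: N x => [|N IH] x; first by rewrite big_ord0.
rewrite big_ord_recl /=; apply: le_trans (fsup x); rewrite lerD2l.
rewrite /avg -mulr_sumr exchange_big /=.
by rewrite ler_wpM2l ?invr_ge0 // ler_sum.
Qed.

Lemma green_le (f : V -> R) x y : (forall z, 0 <= f z) ->
  (forall z, (z == y)%:R + avg f z <= f z) ->
  (green E PX X x y <= (f x / (deg E y)%:R)%:E)%E.
Proof.
move=> f0 fsup; rewrite /green mulrC EFinM lee_wpmul2l //.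
have e1 k : (fun w => ((X k w == y)%:R)%:E) = EFin \o \1_[set w | X k w = y]
    :> (OX -> \bar R).
  apply/funext => w; rewrite /= indicE; congr (_%:R%:E); congr nat_of_bool.
  by apply/eqP/idP; rewrite inE.
rewrite integral_nneseries //; last first.
  move=> k; rewrite e1; apply/measurable_EFinP/measurable_indic.
  exact: measurable_srw_eq.
apply: lime_le; first by apply: is_cvg_nneseries => n _ _; exact: integral_ge0.
apply: nearW => N; rewrite big_mkord.
apply: le_trans (_ : ((\sum_(k < N) iter k avg (fun z => (z == y)%:R) x)%:E <=
  _)%E); last first.
  by rewrite lee_fin sum_iter_avg_le.
rewrite -sumEFin; apply: lee_sum => k _.
apply: le_trans (srw_at_le k x y).
by rewrite e1 integral_indic // ?setIT //; exact: measurable_srw_eq.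
Qed.

Lemma transientP (f : V -> R) x : (forall z, 0 <= f z) -> 1 <= f x ->
  (forall z, z != x -> avg f z <= f z) -> avg f x < 1 ->
  (PX x [set w | exists2 k, (1 <= k)%N & X k w = x] < 1)%E.
Proof.
move=> f0 fx fsup fx1.
have := @srw_avoid_ge [fset x]%fset f x f0.
pose B := [set w | exists2 k, (1 <= k)%N & X k w = x]; rewrite -/B.
have mB : measurable B.
  rewrite (_ : B = \bigcup_(k in [set k | (1 <= k)%N]) [set w | X k w = x]) //.
  by apply: bigcup_measurable => k _; exact: measurable_srw_eq.
have -> : [set w | forall k, (1 <= k)%N -> X k w \notin [fset x]%fset] = ~` B.
  apply/seteqP; split=> w /=.
    by move=> h [k k1 kx]; have := h k k1; rewrite kx in_fset1 eqxx.
  by move=> h k k1; rewrite in_fset1; apply/eqP => kx; apply: h; exists k.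
rewrite probability_setC //.
rewrite -(fineK (fin_num_measure (PX x) _ mB)) -EFinB lee_fin lte_fin => h.
have : 1 - avg f x <= 1 - fine (PX x B).
  by apply: h => z; rewrite in_fset1; [move/eqP -> | exact: fsup].
lra.
Qed.

End Walk.

(** * Superharmonic functions, transience and capacity *)

Section Superharmonic.
Variables (R : realType) (V : choiceType) (E : rel V) (x0 : V).
Hypothesis htree : is_tree E.
Hypothesis hchildren : forall x, nchildren E x0 x = maxn 1 (gdist E x0 x).

Local Notation lev := (gdist E x0).
Local Notation par := (par E x0).
Local Notation children := (children E x0).
Local Notation avg := (@avg V E R).
Let deg0 x : (0 < deg E x)%N := deg_gt0 htree hchildren x.

Lemma avg_le_half (f : V -> R) x : (1 < lev x)%N -> 0 <= f x ->
  f (par x) <= 2 * f x -> (forall z, z \in children x -> f z <= f x / 2) ->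
  avg f x <= f x.
Proof.
move=> l1 f0 fp fc.
apply: le_trans (halving_superharmonic l1 f0).
by apply: avg_le fp fc => //; rewrite -(lev_gt0 x0 htree); exact: ltnW.
Qed.

Lemma avg_le_max (f : V -> R) c x : (forall z, f z <= c) -> avg f x <= c.
Proof.
by move=> fc; rewrite -[leRHS](avg_cst c (deg0 x)); exact: ler_avg.
Qed.

(** ** Decay with the level *)

(** The gain at level [j] is what makes four times this function dominate the
   expected number of visits to any vertex of that level. *)
Lemma half_level_superharmonic j z : (0 < j)%N ->
  (lev z == j)%:R / 4 + avg (fun z => (1 / 2) ^+ (lev z - j)) z <=
    (1 / 2) ^+ (lev z - j).
Proof.
move=> j0; set f := fun z => _.
have f0 u : 0 <= f u by rewrite exprn_ge0 // divr_ge0.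
have f1 u : f u <= 1 by rewrite exprn_ile1 //; lra.
rewrite -/(f z); case: (ltngtP (lev z) j) => lz.
- rewrite mul0r add0r {2}/f (eqP (ltnW lz : (lev z - j == 0)%N)) expr0.
  exact: avg_le_max.
- rewrite mul0r add0r; apply: avg_le_half => //; first exact: leq_ltn_trans lz.
    rewrite /f (lev_par x0 htree).
    by rewrite (_ : lev z - j = ((lev z).-1 - j).+1)%N; [rewrite exprS; lra | lia].
  move=> u /(childP htree)[_ lu]; rewrite /f lu subSn ?(ltnW lz) // exprS; lra.
- rewrite {2}/f lz subnn expr0.
  have zx0 : z != x0 by rewrite -(lev_gt0 x0 htree) lz.
  have h : avg f z <= (1 + (lev z)%:R * (1 / 2)) / (lev z).+1%:R.
    apply: avg_le => // u /(childP htree)[_ lu].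
    by rewrite /f lu lz subSn // subnn expr1.
  suff h' : (1 + (lev z)%:R * (1 / 2)) / (lev z).+1%:R <= (3 / 4 : R).
    by rewrite /= mul1r; have := le_trans h h'; lra.
  rewrite ler_pdivrMr ?ltr0n // -[(lev z).+1%:R]natr1.
  have : 1 <= (lev z)%:R :> R by rewrite ler1n lz.
  lra.
Qed.

(** A vertex at level 1 has a single child, so that the geometric profile is
   flattened there. *)
Lemma root_superharmonic (f := fun z => if lev z == 0%N then 1 else
    if lev z == 1%N then 3 / 4 else 2 * (1 / 2) ^+ lev z : R) z :
  z != x0 -> avg f z <= f z.
Proof.
have e0 n : 0 <= (1 / 2) ^+ n :> R by rewrite exprn_ge0 // divr_ge0.
have fge2 u : (1 < lev u)%N -> f u = 2 * (1 / 2) ^+ lev u.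
  by rewrite /f; case: (lev u) => [|[]].
move=> zx0; have := zx0; rewrite -(lev_gt0 x0 htree) leq_eqVlt => /orP[/eqP l1|l2].
  have := @avg_le _ _ _ htree hchildren _ f z 1 (1 / 2) zx0.
  rewrite -l1 => h; have -> : f z = 3 / 4 by rewrite /f -l1.
  apply: (le_trans (h _ _)); last by lra.
    by rewrite /f (lev_par x0 htree) -l1.
  move=> u /(childP htree)[_ lu]; rewrite fge2 lu -l1 //.
  by rewrite !exprS expr0; lra.
apply: avg_le_half => //.
- by rewrite fge2 // mulr_ge0.
- rewrite (fge2 z) //; move: l2; rewrite /f (lev_par x0 htree).
  case: (lev z) => [|[|[|n]]] //= _; last by rewrite !exprS; lra.
  by rewrite !exprS expr0; lra.
- move=> u /(childP htree)[_ lu]; rewrite !fge2 // lu; last exact: ltnW.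
  by rewrite exprS; lra.
Qed.

Section Walk.
Variables (dX : measure_display) (OX : measurableType dX).
Variables (PX : V -> probability OX R) (X : nat -> OX -> V).
Hypothesis hX : is_srw E PX X.

Lemma green_bound x y : y != x0 ->
  (green E PX X x y <=
     (4 * (1 / 2) ^+ (lev x - lev y) / (lev y).+1%:R)%:E)%E.
Proof.
move=> yx0; rewrite -(degE htree hchildren yx0).
apply: (green_le htree deg0 hX
  (f := fun z => 4 * (1 / 2) ^+ (lev z - lev y))) => z.
  by rewrite mulr_ge0 // exprn_ge0 // divr_ge0.
have := @half_level_superharmonic (lev y) z; rewrite (lev_gt0 x0 htree) => /(_ yx0).
rewrite /avg -mulr_sumr; set s := \sum_(_ <- _) _.
have : (z == y)%:R <= (lev z == lev y)%:R :> R.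
  by rewrite ler_nat; case: eqP => // ->; rewrite eqxx.
lra.
Qed.

Lemma srw_transient : transient PX X.
Proof.
move=> x; have [->|xx0] := eqVneq x x0.
  apply: (transientP htree deg0 hX (f := fun z => if lev z == 0%N then 1 else
    if lev z == 1%N then 3 / 4 else 2 * (1 / 2) ^+ lev z)).
  - move=> z; case: ifP => // _; case: ifP => _; first lra.
    by rewrite mulr_ge0 // exprn_ge0 // divr_ge0.
  - by rewrite (lev_root x0 htree).
  - by move=> z; exact: root_superharmonic.
  - apply: (@le_lt_trans _ _ (3 / 4)); last by lra.
    apply: avg_root_le => // u /(childP htree)[_].
    by rewrite (lev_root x0 htree) => ->.
apply: (transientP htree deg0 hX (f := fun z => (1 / 2) ^+ (lev z - lev x))).
- by move=> z; rewrite exprn_ge0 // divr_ge0.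
- by rewrite subnn.
- move=> z zx; have := @half_level_superharmonic (lev x) z.
  rewrite (lev_gt0 x0 htree) => /(_ xx0); apply: le_trans.
  by rewrite lerDr divr_ge0.
- have := @half_level_superharmonic (lev x) x.
  rewrite (lev_gt0 x0 htree) => /(_ xx0); rewrite eqxx subnn expr0 mulr1n; lra.
Qed.

(** ** Capacity of a vertical path *)

Section DistTo.
Variable K : pred V.

(** [half_dist K z] is [2 ^- k], where [k] is the least number of steps towards
    the root that lead from [z] into [K], a set meant to contain the root.  The
    recursion has [n] steps left, which suffices from [n = lev z] on. *)
Fixpoint half_dist_rec (n : nat) (z : V) : R :=
  if K z then 1 else if n is n'.+1 then half_dist_rec n' (par z) / 2 else 1.

Definition half_dist (z : V) : R := half_dist_rec (lev z) z.

Lemma half_dist_in z : K z -> half_dist z = 1.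
Proof. by rewrite /half_dist; case: (lev z) => /= [|n] ->. Qed.

Lemma half_dist_notin z : z != x0 -> ~~ K z ->
  half_dist z = half_dist (par z) / 2.
Proof.
move=> zx0 /negPf Kz; rewrite /half_dist (lev_par x0 htree).
by move: zx0; rewrite -(lev_gt0 x0 htree); case: (lev z) => //= n _; rewrite Kz.
Qed.

Lemma half_dist_ge0 z : 0 <= half_dist z.
Proof.
rewrite /half_dist; move: (lev z) => n; elim: n z => [|n IH] z /=; first by case: ifP.
by case: ifP => // _; rewrite divr_ge0.
Qed.

Lemma half_dist_le1 z : half_dist z <= 1.
Proof.
rewrite /half_dist; move: (lev z) => n; elim: n z => [|n IH] z /=; first by case: ifP.
by case: ifP => // _; have := IH (par z); lra.
Qed.

Hypothesis Kpar : forall z, K z -> K (par z).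
Hypothesis Klow : forall z, (lev z <= 1)%N -> K z.

Lemma half_dist_child z u : ~~ K z -> u \in children z ->
  half_dist u = half_dist z / 2.
Proof.
move=> Kz /(childP htree)[pu lu]; rewrite half_dist_notin ?pu //.
  by rewrite -(lev_gt0 x0 htree) lu.
by apply: contra Kz => /Kpar; rewrite pu.
Qed.

Lemma half_dist_superharmonic z : ~~ K z -> avg half_dist z <= half_dist z.
Proof.
move=> Kz.
have lz : (1 < lev z)%N by rewrite ltnNge; apply: contra Kz; exact: Klow.
apply: avg_le_half => //; first exact: half_dist_ge0.
- rewrite [half_dist z]half_dist_notin //; first by lra.
  by rewrite -(lev_gt0 x0 htree); exact: ltnW.
- by move=> u /(half_dist_child Kz) ->.
Qed.

End DistTo.

Lemma iter_par_inj y i j : (i <= lev y)%N -> (j <= lev y)%N ->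
  iter i par y = iter j par y -> i = j.
Proof.
move=> il jl /(congr1 lev); rewrite !(lev_iter_par x0 htree); lia.
Qed.

(** The vertical path formed by [y] and its first [N.-1] ancestors. *)
Definition vpath (y : V) (N : nat) : {fset V} :=
  [fset z in traject par y N]%fset.

Lemma in_vpath y N z :
  reflect (exists2 i, (i < N)%N & z = iter i par y) (z \in vpath y N).
Proof. by rewrite inE; exact: trajectP. Qed.

Lemma big_vpath (T : Type) (idx : T) (op : Monoid.com_law idx) y N F :
  (N <= lev y)%N ->
  \big[op/idx]_(z <- vpath y N) F z = \big[op/idx]_(i < N) F (iter i par y).
Proof.
move=> Ny; rewrite (perm_big [seq iter i par y | i <- iota 0 N]).
  by rewrite big_map -{1}(subn0 N) -/(index_iota 0 N) big_mkord.
apply: uniq_perm; first exact: fset_uniq.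
  rewrite map_inj_in_uniq ?iota_uniq // => i j.
  rewrite !mem_iota !add0n /= => iN jN; apply: iter_par_inj; lia.
move=> z; apply/in_vpath/mapP => -[i iN ->]; exists i => //.
  by rewrite mem_iota.
by rewrite mem_iota in iN.
Qed.

Lemma sum_vpath_lev_ge y N : (N < lev y)%N ->
  ('C(N, 2) <= \sum_(i < N) (lev (iter i par y)).-1)%N.
Proof.
move=> Ny; rewrite -bin2_sum big_nat_rev big_mkord /=.
apply: leq_sum => i _; rewrite (lev_iter_par x0 htree); lia.
Qed.

Lemma sum_eq_le1 (s : seq V) a : uniq s ->
  \sum_(z <- s) (z == a)%:R <= 1 :> R.
Proof.
move=> us; rewrite -natr_sum -[leRHS]/(1%:R) ler_nat.
rewrite (eq_bigr (fun z => if z == a then 1 else 0)%N); last first.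
  by move=> z _; case: eqP.
by rewrite -big_mkcond sum1_count count_uniq_mem // leq_b1.
Qed.

(** Each child off the path, and there are at least [|x| - 1] of them, leads back
   to the path with probability at most 1/2. *)
Lemma escape_vpath y N i : (N < lev y)%N -> (i < N)%N ->
  (((lev (iter i par y)).-1%:R / 2)%:E <=
   (deg E (iter i par y))%:R%:E *
   PX (iter i par y)
     [set w | forall k, (1 <= k)%N -> X k w \notin vpath y N])%E.
Proof.
move=> Ny iN; set x := iter i par y.
have lx : lev x = (lev y - i)%N by rewrite (lev_iter_par x0 htree).
have xx0 : x != x0 by rewrite -(lev_gt0 x0 htree) lx; lia.
(* The levels up to that of the parent of the last vertex of the path are added,
   so that the set is closed under parents and includes levels 0 and 1. *)
pose K := [pred z | (z \in vpath y N) || (lev z <= lev y - N)%N].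
have Kpar z : K z -> K (par z).
  rewrite /= => /orP[|zl]; last by rewrite (lev_par x0 htree); apply/orP; right; lia.
  case/in_vpath => j jN ->; rewrite -iterS.
  have [j1N|Nj1] := ltnP j.+1 N.
    by apply/orP; left; apply/in_vpath; exists j.+1.
  by apply/orP; right; rewrite (lev_iter_par x0 htree); lia.
have Klow z : (lev z <= 1)%N -> K z.
  by move=> zl /=; apply/orP; right; lia.
have h : ((1 - avg (half_dist K) x)%:E <= PX x
     [set w | forall k, (1 <= k)%N -> X k w \notin vpath y N])%E.
  apply: (srw_avoid_ge htree deg0 hX).
  - exact: half_dist_ge0.
  - by move=> z zK; rewrite half_dist_in //= zK.
  - move=> z zK; case: (boolP (K z)) => Kz; last first.
      exact: half_dist_superharmonic.
    rewrite half_dist_in //; apply: avg_le_max; exact: half_dist_le1.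
apply: (@le_trans _ _ ((deg E x)%:R%:E * (1 - avg (half_dist K) x)%:E)%E);
  last by rewrite lee_wpmul2l.
have d1 : (deg E x)%:R * (1 - avg (half_dist K) x) =
    \sum_(z <- nbrs E x) (1 - half_dist K z).
  have dx : (deg E x)%:R != 0 :> R by rewrite pnatr_eq0 -lt0n.
  rewrite -[X in X - _](avg_cst 1 (deg0 x)) -avgB.
  by rewrite /avg mulrA divff // mul1r.
rewrite -EFinM lee_fin d1 (sum_nbrs htree _ xx0).
(* At most one child of [x] lies on the path. *)
set z0 := iter i.-1 par y.
have hz z : z \in children x -> (1 - (z == z0)%:R) / 2 <= 1 - half_dist K z.
  move=> zx; have [pz lz] := childP htree zx.
  have [->|zz0] := eqVneq z z0.
    by rewrite subrr mul0r subr_ge0 half_dist_le1.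
  have Kx : K x by rewrite /=; apply/orP; left; apply/in_vpath; exists i.
  have [Kz|Kz] := boolP (K z); last first.
    rewrite half_dist_notin ?pz ?half_dist_in //.
      by rewrite mulr0n; lra.
    by rewrite -(lev_gt0 x0 htree) lz.
  exfalso; move: Kz => /= /orP[/in_vpath[j jN zj]|]; last by rewrite lz lx; lia.
  have : lev z = (lev y - j)%N by rewrite zj (lev_iter_par x0 htree).
  rewrite lz lx => h1; have ij : j = i.-1 by lia.
  by move: zz0; rewrite zj ij eqxx.
have hp : 0 <= 1 - half_dist K (par x) by rewrite subr_ge0 half_dist_le1.
apply: (@le_trans _ _ (\sum_(z <- children x) (1 - (z == z0)%:R) / 2)); last first.
  rewrite -[leLHS]add0r lerD // big_seq [leRHS]big_seq; exact: ler_sum.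
rewrite -mulr_suml ler_wpM2r // sumrB.
have -> : \sum_(z <- children x) (1 : R) = (lev x)%:R.
  rewrite big_const_seq count_predT iter_addr_0.
  rewrite -[size _]/(#|` children x|) (card_children hchildren).
  by congr (_%:R); lia.
have := sum_eq_le1 z0 (fset_uniq (children x)).
have l1 : (1 <= lev x)%N by rewrite (lev_gt0 x0 htree).
have -> : (lev x)%:R = (lev x).-1%:R + 1 :> R by rewrite natr1 prednK.
lra.
Qed.

Lemma cap_vpath_ge y N : (N < lev y)%N ->
  (('C(N, 2)%:R / 2)%:E <= cap E PX X (vpath y N))%E.
Proof.
move=> Ny; rewrite /cap big_vpath; last exact: ltnW.
apply: (@le_trans _ _ (\sum_(i < N) ((lev (iter i par y)).-1%:R / 2)%:E)%E).
  rewrite sumEFin lee_fin -mulr_suml ler_wpM2r // -natr_sum ler_nat.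
  exact: sum_vpath_lev_ge.
by apply: lee_sum => i _; exact: escape_vpath.
Qed.

End Walk.
End Superharmonic.

(** * Gaussian tails *)

Section NormalBounds.
Variable R : realType.
Implicit Types m s a b c t : R.

Let mu := @lebesgue_measure R.

Lemma measurable_normal_pdfE m s (A : set R) :
  measurable_fun A (fun x => (normal_pdf m s x)%:E).
Proof.
apply: measurable_funTS; apply/measurable_EFinP; exact: measurable_normal_pdf.
Qed.

Lemma normal_prob_le_itv m s a b c : a <= b ->
  (forall x, normal_pdf m s x <= c) ->
  (normal_prob m s `[a, b] <= (c * (b - a))%:E)%E.
Proof.
move=> ab pc; rewrite /normal_prob.
apply: (@le_trans _ _ (\int[mu]_(x in `[a, b]) (cst c%:E x))%E).
  apply: ge0_le_integral => //.
  - by move=> x _; rewrite lee_fin normal_pdf_ge0.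
  - exact: measurable_normal_pdfE.
  - by move=> x _; rewrite lee_fin pc.
rewrite integral_cst // [X in (_ * X)%E]lebesgue_measure_itv /= lte_fin.
case: ltP => [_|ba]; first by rewrite -EFinB -EFinM.
by rewrite mule0 lee_fin (_ : b - a = 0) ?mulr0 //; lra.
Qed.

Lemma normal_prob_ge_itv m s a b c : a <= b -> 0 <= c ->
  (forall x, a <= x <= b -> c <= normal_pdf m s x) ->
  ((c * (b - a))%:E <= normal_prob m s `[a, b])%E.
Proof.
move=> ab c0 pc; rewrite /normal_prob.
apply: (@le_trans _ _ (\int[mu]_(x in `[a, b]) (cst c%:E x))%E).
  rewrite integral_cst // [X in (_ * X)%E]lebesgue_measure_itv /= lte_fin.
  case: ltP => [_|ba]; first by rewrite -EFinB -EFinM.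
  by rewrite mule0 lee_fin (_ : b - a = 0) ?mulr0 //; lra.
by apply: ge0_le_integral => //; exact: measurable_normal_pdfE.
Qed.

(** Completing the square bounds the density of mean [m] on [t, +oo[ by
   [expR (- (t - m) ^+ 2 / (s ^+ 2 *+ 2))] times the density of mean [t]. *)
Lemma normal_prob_tail m s t : s != 0 -> m <= t ->
  (normal_prob m s `[t, +oo[ <= (expR (- (t - m) ^+ 2 / (s ^+ 2 *+ 2)))%:E)%E.
Proof.
move=> s0 mt; set e := expR _.
have e0 : 0 <= e by exact: expR_ge0.
apply: (@le_trans _ _ (\int[mu]_(x in `[t, +oo[) (e%:E * (normal_pdf t s x)%:E))%E).
  apply: ge0_le_integral => //.
  - by move=> x _; rewrite lee_fin normal_pdf_ge0.
  - exact: measurable_normal_pdfE.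
  - apply: measurable_funeM; exact: measurable_normal_pdfE.
  move=> x /=; rewrite in_itv /= andbT => tx; rewrite lee_fin !normal_pdfE //.
  rewrite mulrCA ler_wpM2l ?normal_peak_ge0 // /normal_fun -expRD ler_expR.
  rewrite -mulrDl ler_wpM2r ?invr_ge0 ?mulrn_wge0 ?sqr_ge0 //.
  have := mulr_ge0 (_ : 0 <= x - t) (_ : 0 <= t - m).
  by rewrite !subr_ge0 => /(_ tx mt); nra.
rewrite ge0_integralZl //; last first.
- by move=> x _; rewrite lee_fin normal_pdf_ge0.
- exact: measurable_normal_pdfE.
rewrite -[leRHS]mule1 lee_wpmul2l //.
by rewrite -[X in (X <= _)%E]/(normal_prob t s `[t, +oo[) probability_le1.
Qed.

Lemma normal_peak_mul_sqr s : 0 < s -> (s * normal_peak s) ^+ 2 * (pi *+ 2) = 1.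
Proof.
move=> s0; rewrite /normal_peak exprMn exprVn sqr_sqrtr; last first.
  by rewrite mulrn_wge0 // mulr_ge0 ?sqr_ge0 // pi_ge0.
have p0 : (pi : R) != 0 by rewrite gt_eqF // pi_gt0.
by move: (pi) p0 => p p0; field; rewrite p0 gt_eqF.
Qed.

End NormalBounds.

Section GaussianTail.
Variables (R : realType) (d : measure_display) (W : measurableType d).
Variable P : probability W R.

Lemma probability_abs_ge (Z : W -> R) (v r : R) : measurable_fun setT Z ->
  0 < r -> (\int[P]_w ((Z w) ^+ 2)%:E <= v%:E)%E ->
  (P [set w | (r <= `|Z w|)%R] <= (v / r ^+ 2)%:E)%E.
Proof.
move=> mZ r0 hv; set A := [set w | _].
have mA : measurable A.
  rewrite -[A]setTI; apply: (measurable_fun_le (f := cst r)) => //.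
  exact: measurableT_comp.
have mZ2 B : measurable_fun B (fun w => ((Z w) ^+ 2)%:E).
  apply: measurable_funTS; apply/measurable_EFinP; exact: measurable_funX.
have r2 : 0 < r ^+ 2 by rewrite exprn_gt0.
rewrite mulrC EFinM lee_pdivlMl //.
apply: le_trans hv.
apply: (@le_trans _ _ (\int[P]_(w in A) ((Z w) ^+ 2)%:E)%E); last first.
  by apply: ge0_subset_integral => // w _; rewrite lee_fin sqr_ge0.
rewrite -(integral_cst P mA); apply: ge0_le_integral => //.
- by move=> w _; rewrite lee_fin ltW.
- move=> w /= Aw; rewrite lee_fin -[(Z w) ^+ 2]ger0_norm ?sqr_ge0 // normrX.
  by rewrite lerXn2r ?nnegrE // ltW.
Qed.

(** The law of [Z] is normal, or a point mass, with unknown mean and deviation.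
   Chebyshev's inequality at three times [sqrt v] bounds both: a large deviation
   would leave too little mass near 0, and a large mean too much mass away from
   0. *)
Lemma gaussian_tail (Z : W -> R) (v t : R) : measurable_fun setT Z ->
  is_gaussian P Z -> 0 < v -> 0 <= t ->
  (\int[P]_w ((Z w) ^+ 2)%:E <= v%:E)%E ->
  (P [set w | (t <= Z w)%R] <= (expR (1 - t ^+ 2 / (96 * v)))%:E)%E.
Proof.
move=> mZ [m [s [s0 lawZ]]] v0 t0 hv.
have mpre (A : set R) : measurable A -> measurable (Z @^-1` A).
  by move=> mA; rewrite -[Z @^-1` A]setTI; exact: mZ.
pose r := 3 * Num.sqrt v.
have sv0 : 0 < Num.sqrt v by rewrite sqrtr_gt0.
have r0 : 0 < r by rewrite mulr_gt0.
have r2 : r ^+ 2 = 9 * v by rewrite exprMn sqr_sqrtr ?ltW //; congr (_ * _); ring.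
have cheb : (P [set w | (r <= `|Z w|)%R] <= (1 / 9)%:E)%E.
  apply: le_trans (probability_abs_ge mZ r0 hv) _.
  by rewrite lee_fin r2 ler_pdivrMr; [lra | rewrite mulr_gt0].
have m_abs : measurable [set w | (r <= `|Z w|)%R].
  rewrite -[X in measurable X]setTI; apply: (measurable_fun_le (f := cst r)) => //.
  exact: measurableT_comp.
have -> : [set w | t <= Z w] = Z @^-1` `[t, +oo[.
  by apply/seteqP; split=> w /=; rewrite in_itv /= andbT.
have [tr|rt] := ltP t (2 * r).
  apply: (@le_trans _ _ 1%E); first by rewrite probability_le1 //; exact: mpre.
  rewrite -[1%E]/(1%:E) lee_fin -[X in X <= _](expR0 R) ler_expR subr_ge0.
  rewrite ler_pdivrMr ?mulr_gt0 // mul1r; nra.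
have pos_le (A : set R) : measurable A -> (forall x, A x -> r <= x) ->
    (P (Z @^-1` A) <= (1 / 9)%:E)%E.
  move=> mA Ar; apply: le_trans cheb; rewrite le_measure ?inE //; first exact: mpre.
  by move=> w /Ar h; rewrite /= (le_trans h) // ler_norm.
case: (eqVneq s 0) lawZ => [_ lawZ|sn0 lawZ].
  have := pos_le [set` `[t, +oo[] (measurable_itv _).
  rewrite lawZ // diracE; case: (m \in _) => /=; last first.
    by move=> _; rewrite lee_fin expR_ge0.
  move=> h; exfalso.
  have : (1%:E <= (1 / 9 : R)%:E)%E.
    apply: h => x /=; rewrite in_itv /= andbT; apply: le_trans.
    by apply: le_trans rt; lra.
  by rewrite lee_fin; lra.
have sp : 0 < s by rewrite lt_neqAle eq_sym sn0.
have peak1 := normal_peak_mul_sqr sp.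
have peak0 := normal_peak_ge0 s.
have pi2 := pi_ge2 R.
have pi4 : (pi : R) <= 4 by have /andP[_] := pihalf_02 R; lra.
have sbound : s ^+ 2 <= 12 * v.
  have : ((8 / 9)%:E <= (normal_peak s * (r - - r))%:E)%E.
    apply: (@le_trans _ _ (normal_prob m s `[- r, r])); last first.
      apply: normal_prob_le_itv; first by lra.
      by move=> x; exact: normal_pdf_ub.
    rewrite -lawZ //.
    apply: (@le_trans _ _ (P (~` [set w | (r <= `|Z w|)%R]))).
      rewrite probability_setC //.
      rewrite -(fineK (fin_num_measure P _ m_abs)) -EFinB lee_fin.
      move: cheb; rewrite -[X in (X <= _)%E](fineK (fin_num_measure P _ m_abs)).
      by rewrite lee_fin; lra.
    rewrite le_measure ?inE //; first exact: measurableC.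
      exact: mpre.
    move=> w /= /negP; rewrite -ltNge in_itv /= => /ltW.
    by rewrite ler_norml.
  rewrite lee_fin => h.
  have p2 : 16 / 81 <= normal_peak s ^+ 2 * r ^+ 2.
    rewrite -exprMn (_ : 16 / 81 = (4 / 9) ^+ 2); last by field.
    by rewrite lerXn2r ?nnegrE ?mulr_ge0 //; lra.
  rewrite r2 in p2; move: peak1; rewrite exprMn.
  have := sqr_ge0 s; have := sqr_ge0 (normal_peak s).
  move: (s ^+ 2) (normal_peak s ^+ 2) p2 => S N p2 N0 S0 peak1.
  have : 4 * (S * N) <= 1 by rewrite -peak1 mulrC; nra.
  nra.
have mr : m < r.
  rewrite ltNge; apply/negP => rm.
  have h : ((normal_peak s / 2 * (m + s - m))%:E <= (1 / 9)%:E)%E.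
    apply: (@le_trans _ _ (normal_prob m s `[m, m + s])).
      apply: normal_prob_ge_itv; [lra | by rewrite divr_ge0 |].
      move=> x /andP[mx xm]; rewrite normal_pdfE // ler_wpM2l //.
      apply: (@le_trans _ _ (1 + - (1 / 2))); first by lra.
      apply: le_trans (expR_ge1Dx _) _; rewrite ler_expR mulNr lerN2.
      rewrite ler_pdivrMr ?mulrn_wgt0 ?exprn_gt0 //.
      have -> : 1 / 2 * (s ^+ 2 *+ 2) = s ^+ 2 by field.
      by rewrite lerXn2r ?nnegrE //; lra.
    rewrite -lawZ //; apply: pos_le => // x /=; rewrite in_itv /= => /andP[h _].
    exact: le_trans h.
  move: h; rewrite lee_fin => h.
  have h2 : (s * normal_peak s) ^+ 2 <= (2 / 9) ^+ 2.
    by rewrite lerXn2r ?nnegrE ?mulr_ge0 //; lra.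
  move: peak1; have := sqr_ge0 (s * normal_peak s).
  move: h2; set q := (s * _) ^+ 2; nra.
rewrite lawZ //; apply: le_trans (normal_prob_tail sn0 _) _.
  by apply: le_trans rt; lra.
rewrite lee_fin ler_expR.
have s2 : 0 < s ^+ 2 by rewrite exprn_gt0.
apply: (@le_trans _ _ (- (t ^+ 2 / (96 * v)))); last by lra.
rewrite mulNr lerN2 ler_pdivrMr ?mulr_gt0 // mulrAC ler_pdivlMr ?mulrn_wgt0 //.
have tm : (t / 2) ^+ 2 <= (t - m) ^+ 2 by rewrite lerXn2r ?nnegrE //; lra.
have := ler_pM (sqr_ge0 (t / 2)) (ltW s2) tm sbound.
nra.
Qed.

End GaussianTail.

(** * The Gaussian free field on vertical paths *)

Section SecondMoment.
Variables (R : realType) (V : choiceType) (g : V -> V -> \bar R).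
Variables (d : measure_display) (W : measurableType d) (P : probability W R).
Variable phi : V -> {RV P >-> R}.
Hypothesis hphi : is_gff g phi.

Lemma gff_integral_mul x y : (\int[P]_w (phi x w * phi y w)%:E)%E = g x y.
Proof.
rewrite -(gff_covariance hphi) covariance.unlock !(gff_centered hphi) /=.
rewrite expectation.unlock; apply: eq_integral => w _ /=.
by rewrite !fctE /= !subr0.
Qed.

Lemma gff_sym x y : g x y = g y x.
Proof. by rewrite -!(gff_covariance hphi) covarianceC. Qed.

Lemma gff_integrable_mul x y : (g x x < +oo)%E -> (g y y < +oo)%E ->
  P.-integrable setT (fun w => (phi x w * phi y w)%:E).
Proof.
move=> gx gy.
have sq z : (g z z < +oo)%E ->
    P.-integrable setT (fun w => (phi z w * phi z w)%:E).
  move=> gz; apply/integrableP; split.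
    by apply/measurable_EFinP; exact: measurable_funM.
  rewrite (eq_integral (fun w => (phi z w * phi z w)%:E)).
    by rewrite gff_integral_mul.
  by move=> w _; rewrite gee0_abs // lee_fin -expr2 sqr_ge0.
apply: (le_integrable measurableT _ _ (integrableD measurableT (sq x gx) (sq y gy))).
  by apply/measurable_EFinP; exact: measurable_funM.
move=> w _; rewrite /= lee_fin.
rewrite [leRHS]ger0_norm ?addr_ge0 -?expr2 ?sqr_ge0 //.
rewrite ler_norml; apply/andP; split.
  have := sqr_ge0 (phi x w + phi y w); have := sqr_ge0 (phi x w).
  have := sqr_ge0 (phi y w); nra.
have := sqr_ge0 (phi x w - phi y w); have := sqr_ge0 (phi x w).
have := sqr_ge0 (phi y w); nra.
Qed.

Lemma gff_second_moment_le n (p : 'I_n -> V) (a : 'I_n -> R)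
    (G : 'I_n -> 'I_n -> R) :
  (forall i j, 0 <= a i * a j) ->
  (forall i j, (g (p i) (p j) <= (G i j)%:E)%E) ->
  (\int[P]_w ((\sum_(i < n) a i * phi (p i) w) ^+ 2)%:E <=
    (\sum_(i < n) \sum_(j < n) a i * a j * G i j)%:E)%E.
Proof.
move=> a0 gG.
have gfin i : (g (p i) (p i) < +oo)%E by exact: le_lt_trans (gG i i) (ltry _).
have ia i j : P.-integrable setT
    (fun w => (a i * a j)%:E * (phi (p i) w * phi (p j) w)%:E)%E.
  by apply: integrableZl => //; exact: gff_integrable_mul.
rewrite (eq_integral (fun w => \sum_(i < n) \sum_(j < n)
    ((a i * a j)%:E * (phi (p i) w * phi (p j) w)%:E)))%E; last first.
  move=> w _; rewrite expr2 mulr_suml -sumEFin; apply: eq_bigr => i _.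
  rewrite mulr_sumr -sumEFin; apply: eq_bigr => j _.
  by rewrite -EFinM mulrACA.
rewrite integral_sum //; last by move=> i; exact: integrable_sum.
rewrite -sumEFin; apply: lee_sum => i _.
rewrite integral_sum // -sumEFin; apply: lee_sum => j _.
rewrite integralZl //; last by exact: gff_integrable_mul.
by rewrite gff_integral_mul [leRHS]EFinM lee_wpmul2l // lee_fin.
Qed.

End SecondMoment.

Section GreenField.
Variables (R : realType) (V : choiceType) (E : rel V) (x0 : V).
Hypothesis htree : is_tree E.
Hypothesis hchildren : forall x, nchildren E x0 x = maxn 1 (gdist E x0 x).
Variables (dX : measure_display) (OX : measurableType dX).
Variables (PX : V -> probability OX R) (X : nat -> OX -> V).
Hypothesis hX : is_srw E PX X.
Variables (d : measure_display) (W : measurableType d) (P : probability W R).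
Variable phi : V -> {RV P >-> R}.
Hypothesis hphi : is_gff (green E PX X) phi.

Local Notation lev := (gdist E x0).
Local Notation par := (par E x0).
Local Notation vpath := (vpath E x0).

(** The exponent is the distance between [i] and [j], with truncated
   subtractions. *)
Lemma sum_half_pow_dist_le (i N : nat) :
  \sum_(j < N) (1 / 2) ^+ ((i - j) + (j - i)) <= (3 : R).
Proof.
have e0 k : 0 <= (1 / 2) ^+ k :> R by rewrite exprn_ge0 // divr_ge0.
have [Ni|iN] := leqP N i.
  suff h : \sum_(j < N) (1 / 2) ^+ ((i - j) + (j - i)) <= (1 / 2) ^+ (i - N) :> R.
    apply: le_trans h _; apply: (@le_trans _ _ 1); last by lra.
    by rewrite exprn_ile1 //; lra.
  elim: N Ni => [|N IH] Ni; first by rewrite big_ord0.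
  rewrite big_ord_recr /=; have := IH (ltnW Ni).
  have -> : ((i - N) + (N - i) = (i - N.+1).+1)%N by lia.
  have -> : (i - N = (i - N.+1).+1)%N by lia.
  by rewrite exprS; lra.
suff h : \sum_(j < N) (1 / 2) ^+ ((i - j) + (j - i)) <=
    3 - 2 * (1 / 2) ^+ (N - i) :> R.
  by apply: le_trans h _; have := e0 (N - i)%N; lra.
rewrite -(subnKC iN); move: (N - i.+1)%N => k {iN N}.
elim: k => [|k IH].
  rewrite addn0 big_ord_recr /= subnn addn0 expr0 subSnn expr1.
  suff : \sum_(j < i) (1 / 2) ^+ ((i - j) + (j - i)) <= 1 :> R by lra.
  have h m : (m <= i)%N ->
      \sum_(j < m) (1 / 2) ^+ ((i - j) + (j - i)) <= (1 / 2) ^+ (i - m) :> R.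
    elim: m => [|m IH] mi; first by rewrite big_ord0.
    rewrite big_ord_recr /=; have := IH (ltnW mi).
    have -> : ((i - m) + (m - i) = (i - m.+1).+1)%N by lia.
    have -> : (i - m = (i - m.+1).+1)%N by lia.
    by rewrite exprS; lra.
  by have := h i (leqnn i); rewrite subnn.
rewrite addnS big_ord_recr /=.
have -> : ((i - (i.+1 + k)) + (i.+1 + k - i) = k.+1)%N by lia.
have -> : ((i.+1 + k).+1 - i = k.+2)%N by lia.
move: IH; have -> : (i.+1 + k - i = k.+1)%N by lia.
by rewrite [_ ^+ k.+2]exprS; lra.
Qed.

Lemma green_bound_max x y : x != x0 -> y != x0 -> (lev x <= lev y)%N ->
  (green E PX X x y <= (4 * (1 / 2) ^+ (lev y - lev x) / (lev x).+1%:R)%:E)%E.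
Proof. by move=> xx0 yx0 xy; rewrite (gff_sym hphi); exact: green_bound. Qed.

(** If [a i] is the level plus 1 of the [i]-th vertex, then the minimum of [a i]
   and [a j] has inverse at most [1 / a i + 1 / a j].  This separates the two
   indices, and [sum_half_pow_dist_le] sums the geometric factor. *)
Lemma vpath_second_moment y N : (N < lev y)%N ->
  (\int[P]_w ((\sum_(i < N) (lev (iter i par y)).+1%:R * phi (iter i par y) w)
     ^+ 2)%:E <= (24 * \sum_(i < N) (lev (iter i par y)).+1%:R)%:E)%E.
Proof.
move=> Ny; pose p (i : 'I_N) := iter i par y.
have lp i : lev (p i) = (lev y - i)%N by rewrite (lev_iter_par x0 htree).
have p0 i : p i != x0.
  by rewrite -(lev_gt0 x0 htree) lp; have := ltn_ord i; lia.
pose e i j : R := (1 / 2) ^+ ((i - j) + (j - i)).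
have e0 i j : 0 <= e i j by rewrite exprn_ge0 // divr_ge0.
pose a i : R := (lev (p i)).+1%:R.
have a0 i : 0 < a i by rewrite ltr0n.
pose G (i j : 'I_N) := 4 * e i j * ((a i)^-1 + (a j)^-1).
have gG i j : (green E PX X (p i) (p j) <= (G i j)%:E)%E.
  case: (leqP (lev (p j)) (lev (p i))) => ij.
    apply: le_trans (green_bound htree hchildren hX _ (p0 j)) _.
    rewrite lee_fin /G /e (_ : lev (p i) - lev (p j) = i - j + (j - i))%N; last first.
      by move: ij; rewrite !lp; have := ltn_ord i; have := ltn_ord j; lia.
    by rewrite ler_wpM2l ?mulr_ge0 // lerDr invr_ge0 ltW.
  apply: le_trans (green_bound_max (p0 i) (p0 j) (ltnW ij)) _.
  rewrite lee_fin /G /e (_ : lev (p j) - lev (p i) = i - j + (j - i))%N; last first.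
    by move: ij; rewrite !lp; have := ltn_ord i; have := ltn_ord j; lia.
  by rewrite ler_wpM2l ?mulr_ge0 // lerDl invr_ge0 ltW.
apply: le_trans (gff_second_moment_le hphi (p := p) (a := a) _ gG) _.
  by move=> i j; rewrite mulr_ge0 // ltW.
rewrite lee_fin.
have -> : \sum_(i < N) \sum_(j < N) a i * a j * G i j =
    \sum_(i < N) \sum_(j < N) (4 * a i * e i j) +
    \sum_(i < N) \sum_(j < N) (4 * a j * e i j).
  rewrite -big_split; apply: eq_bigr => i _; rewrite -big_split.
  apply: eq_bigr => j _ /=; rewrite /G.
  by field; rewrite !gt_eqF.
rewrite [X in _ + X]exchange_big /=.
have h i : \sum_(j < N) (4 * a i * e i j) <= 12 * a i.
  rewrite -mulr_sumr; have := ler_wpM2l (ltW (a0 i)) (sum_half_pow_dist_le i N).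
  by rewrite -/(e i _); lra.
have h' i : \sum_(j < N) (4 * a i * e j i) <= 12 * a i.
  rewrite (eq_bigr (fun j : 'I_N => 4 * a i * e i j)) // => j _.
  by rewrite /e addnC.
rewrite -big_split mulr_sumr; apply: ler_sum => i _ /=.
have := h i; have := h' i; rewrite -/(a i); lra.
Qed.

Lemma measurable_gff_ge h x : measurable [set w | h <= phi x w].
Proof.
rewrite -[X in measurable X]setTI.
by apply: (measurable_fun_le (f := cst h)).
Qed.

Lemma gff_vpath_ge_le h y N : 0 <= h -> (N < lev y)%N ->
  (P [set w | forall z, z \in vpath y N -> (h <= phi z w)%R] <=
    (expR (1 - (h / 48) ^+ 2 * 'C(N, 2)%:R))%:E)%E.
Proof.
move=> h0 Ny.
set D := [set w | _].
have mD : measurable D.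
  rewrite (_ : D = \bigcap_(z in [set` vpath y N]) [set w | h <= phi z w]) //.
  by apply: fin_bigcap_measurable => // z _; exact: measurable_gff_ge.
have [N0|N0] := posnP N.
  apply: le_trans (probability_le1 P mD) _.
  by rewrite N0 mulr0 subr0 lee_fin; have := expR_ge1Dx (1 : R); lra.
pose a x : R := (lev x).+1%:R.
pose S : R := \sum_(i < N) a (iter i par y).
pose Z w := \sum_(x <- vpath y N) a x * phi x w.
have ZE w : Z w = \sum_(i < N) a (iter i par y) * phi (iter i par y) w.
  by rewrite /Z big_vpath // ltnW.
have Sge : 'C(N, 2)%:R <= S.
  rewrite /S -natr_sum ler_nat; apply: leq_trans (sum_vpath_lev_ge htree Ny) _.
  by apply: leq_sum => i _; lia.
have S0 : 0 < S.
  rewrite /S; case: (N) N0 => // n _; rewrite big_ord_recl ltr_wpDr ?ltr0n //.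
  by rewrite sumr_ge0.
have mZ : measurable_fun setT Z.
  by apply: measurable_sum => x; apply: measurable_funM.
have hv : (\int[P]_w ((Z w) ^+ 2)%:E <= (24 * S)%:E)%E.
  under eq_integral do rewrite ZE.
  exact: vpath_second_moment.
have tail : (P [set w | (h * S <= Z w)%R] <=
    (expR (1 - (h * S) ^+ 2 / (96 * (24 * S))))%:E)%E.
  apply: gaussian_tail => //.
  - exact: gff_gaussian hphi _ _.
  - by rewrite mulr_gt0.
  - by rewrite mulr_ge0 // ltW.
apply: (@le_trans _ _ (P [set w | (h * S <= Z w)%R])).
  rewrite le_measure ?inE //.
    rewrite -[X in measurable X]setTI.
    by apply: (measurable_fun_le (f := cst (h * S))).
  move=> w Dw; rewrite /= ZE /S mulr_sumr; apply: ler_sum => i _.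
  rewrite mulrC ler_wpM2l //; apply: Dw; apply/in_vpath; by exists i.
apply: le_trans tail _; rewrite lee_fin ler_expR lerB //.
have -> : (h * S) ^+ 2 / (96 * (24 * S)) = (h / 48) ^+ 2 * S.
  by field; rewrite gt_eqF.
by apply: ler_wpM2l => //; exact: sqr_ge0.
Qed.

Lemma gff_lt_le h x : h < 0 -> x != x0 ->
  (P [set w | (phi x w < h)%R] <= (expR (1 - (h / 20) ^+ 2 * (lev x).+1%:R))%:E)%E.
Proof.
move=> h0 xx0; pose Z w := \sum_(z <- [fset x]%fset) (-1) * phi z w.
have ZE w : Z w = - phi x w by rewrite /Z big_seq_fset1 mulN1r.
have mZ : measurable_fun setT Z.
  by apply: measurable_sum => z; apply: measurable_funM.
have l0 : 0 < (lev x).+1%:R :> R by rewrite ltr0n.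
have hv : (\int[P]_w ((Z w) ^+ 2)%:E <= (4 / (lev x).+1%:R)%:E)%E.
  under eq_integral do rewrite ZE sqrrN expr2.
  rewrite (gff_integral_mul hphi); apply: le_trans (green_bound htree hchildren hX _ xx0) _.
  by rewrite subnn expr0 mulr1.
have tail : (P [set w | (- h <= Z w)%R] <=
    (expR (1 - (- h) ^+ 2 / (96 * (4 / (lev x).+1%:R))))%:E)%E.
  apply: gaussian_tail => //.
  - exact: gff_gaussian hphi _ (fun=> -1).
  - by rewrite oppr_ge0 ltW.
apply: (@le_trans _ _ (P [set w | (- h <= Z w)%R])).
  rewrite le_measure ?inE //.
  - rewrite (_ : [set w | _] = ~` [set w | h <= phi x w]).
      by apply: measurableC; exact: measurable_gff_ge.
    by apply/seteqP; split=> w /=; rewrite ltNge => /negP.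
  - rewrite -[X in measurable X]setTI.
    by apply: (measurable_fun_le (f := cst (- h))).
  - by move=> w /= hw; rewrite ZE lerN2 ltW.
apply: le_trans tail _; rewrite lee_fin ler_expR.
have -> : (- h) ^+ 2 / (96 * (4 / (lev x).+1%:R)) =
    (h / 20) ^+ 2 * (lev x).+1%:R * (25 / 24) by field; rewrite gt_eqF.
have := mulr_ge0 (sqr_ge0 (h / 20)) (ltW l0); lra.
Qed.

End GreenField.

(** * First-moment criterion for finite components *)

Section Numeric.
Variable R : realType.

Lemma exists_nat_gt (x : R) : exists n : nat, x < n%:R.
Proof.
exists (Num.bound `|x|); apply: le_lt_trans (ler_norm x) _.
exact: archi_boundP (normr_ge0 x).
Qed.

(** The ratio of consecutive terms is eventually at most one half. *)
Lemma fact_expR_small (m : nat) (C c e : R) : 0 < c -> 0 < e ->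
  exists N : nat, (m + N)`!%:R * expR (C - c * 'C(N, 2)%:R) <= e.
Proof.
move=> c0 e0; pose b N := (m + N)`!%:R * expR (C - c * 'C(N, 2)%:R).
have b0 N : 0 < b N by rewrite mulr_gt0 ?expR_gt0 // ltr0n fact_gt0.
have [n0 hn0] := exists_nat_gt (16 / c ^+ 2).
have c2 : 0 < c ^+ 2 by rewrite exprn_gt0.
have step N : (n0 + m.+1 <= N)%N -> b N.+1 <= b N / 2.
  move=> nN; have hN : 16 <= c ^+ 2 * N%:R.
    rewrite mulrC -ler_pdivrMr // (le_trans (ltW hn0)) // ler_nat; lia.
  have N1 : 1 <= N%:R :> R by rewrite ler1n; lia.
  have mN : (m + N).+1%:R <= 2 * N%:R :> R.
    by rewrite -natrM ler_nat; lia.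
  have he : 2 * (m + N).+1%:R <= expR (c * N%:R).
    have h1 : 1 + c * N%:R / 2 <= expR (c * N%:R / 2) by exact: expR_ge1Dx.
    have cN : 0 <= c * N%:R / 2 by rewrite divr_ge0 // mulr_ge0 // ltW.
    have h2 : (c * N%:R / 2) ^+ 2 <= expR (c * N%:R).
      rewrite [X in expR X](_ : _ = c * N%:R / 2 + c * N%:R / 2); last by field.
      rewrite expRD -expr2 lerXn2r ?nnegrE ?expR_ge0 //; lra.
    apply: le_trans h2; apply: (@le_trans _ _ (4 * N%:R)); first by lra.
    have := ler_wpM2r (ler0n R N) hN.
    have -> : (c * N%:R / 2) ^+ 2 = c ^+ 2 * N%:R * N%:R / 4 by field.
    lra.
  rewrite /b addnS factS natrM binS bin1 natrD.
  have -> : C - c * ('C(N, 2)%:R + N%:R) =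
            (C - c * 'C(N, 2)%:R) + - (c * N%:R) by ring.
  rewrite expRD expRN.
  have F0 : 0 <= (m + N)`!%:R * expR (C - c * 'C(N, 2)%:R) :> R by exact: ltW (b0 N).
  rewrite [leLHS](_ : _ = (m + N)`!%:R * expR (C - c * 'C(N, 2)%:R) *
    ((m + N).+1%:R / expR (c * N%:R))).
    rewrite ler_wpM2l // ler_pdivrMr ?expR_gt0 //; lra.
  by rewrite [X in X * _ = _]mulrC mulrACA.
have geo k : b (n0 + m.+1 + k)%N <= b (n0 + m.+1)%N / 2 ^+ k.
  elim: k => [|k IH]; first by rewrite addn0 expr0 divr1.
  rewrite addnS; apply: le_trans (step _ (leq_addr _ _)) _.
  by rewrite exprSr invfM mulrA ler_wpM2r.
have [k hk] := exists_nat_gt (b (n0 + m.+1)%N / e).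
exists (n0 + m.+1 + k)%N; apply: le_trans (geo k) _.
rewrite ler_pdivrMr ?exprn_gt0 // mulrC -ler_pdivrMr // (le_trans (ltW hk)) //.
by rewrite -natrX ler_nat ltnW // ltn_expl.
Qed.

Lemma sum_expR_le (a c : R) n : 0 < c ->
  \sum_(k < n) expR (a - c * k%:R) <= expR a / (1 - expR (- c)).
Proof.
move=> c0; have r1 : 0 < 1 - expR (- c) by rewrite subr_gt0 expR_lt1 oppr_lt0.
rewrite ler_pdivlMr //.
suff -> : (\sum_(k < n) expR (a - c * k%:R)) * (1 - expR (- c)) =
    expR a - expR (a - c * n%:R) by rewrite gerBl expR_ge0.
elim: n => [|n IH]; first by rewrite big_ord0 mul0r mulr0 subr0 subrr.
rewrite big_ord_recr /= mulrDl IH.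
have -> : a - c * n.+1%:R = (a - c * n%:R) + - c by rewrite -natr1; ring.
by rewrite (expRD (a - c * n%:R)); ring.
Qed.

End Numeric.

Section Percolation.
Variables (R : realType) (V : choiceType) (E : rel V) (x0 : V).
Hypothesis htree : is_tree E.
Hypothesis hchildren : forall x, nchildren E x0 x = maxn 1 (gdist E x0 x).
Variables (d : measure_display) (W : measurableType d) (P : probability W R).

Local Notation lev := (gdist E x0).
Local Notation par := (par E x0).
Local Notation children := (children E x0).
Local Notation sphere := (sphere E x0).
Local Notation vpath := (vpath E x0).

Lemma probability_has_le (I : Type) (s : seq I) (B : I -> set W) (b : R) :
  (forall i, measurable (B i)) ->
  (forall i, (P (B i) <= b%:E)%E) ->
  let D := \big[setU/set0]_(i <- s) B i in
  measurable D /\ (P D <= ((size s)%:R * b)%:E)%E.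
Proof.
move=> mB hB /=; elim: s => [|i s [mD IH]].
  by rewrite big_nil measure0 mul0r; split.
rewrite big_cons; split; first exact: measurableU.
apply: le_trans (measureU2 P (mB i) mD) _.
by rewrite /= -natr1 mulrDl mul1r addrC EFinD leeD.
Qed.

(** A walk ending at [y] meets every ancestor of [y] whose level exceeds that
   of its starting point. *)
Lemma walk_meets_ancestor x p i : path E x p ->
  (lev x < lev (iter i par (last x p)))%N -> iter i par (last x p) \in x :: p.
Proof.
elim/last_ind: p i => [|p z IH] i /=.
  by rewrite (lev_iter_par x0 htree) ltnNge leq_subr.
rewrite rcons_path last_rcons => /andP[hp uz].
rewrite -rcons_cons mem_rcons inE.
have [[_ ->]|[_ pz]] := adj_cases x0 htree uz.
  by rewrite -iterSr => h; rewrite IH ?orbT.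
case: i => [|i]; first by rewrite /= eqxx.
by rewrite iterSr pz => h; rewrite IH ?orbT.
Qed.

Lemma finite_lev_lt n : finite_set [set y | (lev y < n)%N].
Proof.
pose s := flatten [seq sphere k | k <- iota 0 n].
apply: (@sub_finite_set _ _ [set` s]); last exact: finite_seq.
move=> y /= yn; apply/flattenP; exists (sphere (lev y)).
  by apply: map_f; rewrite mem_iota.
exact: mem_sphere.
Qed.

(** An infinite component contains, for some [m] and every [N], a vertical path
   of [N] vertices that ends at level [m + N].  There are at most [(m + N)`!]
   such paths. *)
Lemma ae_components_finite (A : W -> set V) (C c : R) : 0 < c ->
  (forall x, measurable [set w | A w x]) ->
  (forall y N, (N < lev y)%N ->
    (P [set w | [set` vpath y N] `<=` A w] <=
      (expR (C - c * 'C(N, 2)%:R))%:E)%E) ->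
  \forall w \ae P, all_components_finite E (A w).
Proof.
move=> c0 mA hA.
have mB y N : measurable [set w | [set` vpath y N] `<=` A w].
  rewrite (_ : [set w | _] = \bigcap_(z in [set` vpath y N]) [set w | A w z]) //.
  by apply: fin_bigcap_measurable.
pose D m N := \big[setU/set0]_(y <- sphere (m.+1 + N))
  [set w | (lev y == m.+1 + N)%N /\ [set` vpath y N] `<=` A w].
have DP m N : measurable (D m N) /\
    (P (D m N) <= ((m.+1 + N)`!%:R * expR (C - c * 'C(N, 2)%:R))%:E)%E.
  have [] := @probability_has_le _ (sphere (m.+1 + N))
    (fun y => [set w | (lev y == m.+1 + N)%N /\ [set` vpath y N] `<=` A w])
    (expR (C - c * 'C(N, 2)%:R)).
  - move=> y; case: eqP => ly.
      by rewrite (_ : [set w | _] = [set w | [set` vpath y N] `<=` A w]) //;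
        apply/seteqP; split=> w // -[].
    by rewrite (_ : [set w | _] = set0) //; apply/seteqP; split=> w // -[].
  - move=> y; case: eqP => ly.
      rewrite (_ : [set w | _] = [set w | [set` vpath y N] `<=` A w]).
        by apply: hA; rewrite ly; lia.
      by apply/seteqP; split=> w // -[].
    rewrite (_ : [set w | _] = set0); last by apply/seteqP; split=> w // -[].
    by rewrite measure0 lee_fin expR_ge0.
  move=> mD hD; split=> //; apply: le_trans hD _.
  rewrite lee_fin ler_wpM2r ?expR_ge0 // ler_nat.
  exact: size_sphere.
have mcap m : measurable (\bigcap_N D m N).
  by apply: bigcapT_measurable => N; case: (DP m N).
apply: (@negligibleS _ _ _ _ (\bigcup_m \bigcap_N D m N)); last first.
  apply: negligible_bigcup => m; exists (\bigcap_N D m N); split=> //.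
  apply/eqP; rewrite eq_le measure_ge0 andbT.
  apply/lee_addgt0Pr => e e0; rewrite add0e.
  have [N hN] := fact_expR_small m.+1 C c0 e0.
  have [mD hD] := DP m N.
  apply: (@le_trans _ _ (P (D m N))).
    by rewrite le_measure ?inE // => w; exact.
  by apply: le_trans hD _; rewrite lee_fin.
move=> w /= /existsNP[x /not_implyP[Ax infx]].
exists (lev x) => // N _.
have [y' [[p [hp lp] Ap] ly']] : exists y', graph_component E (A w) x y' /\
    ((lev x).+1 + N <= lev y')%N.
  apply: contrapT => /forallNP h; apply: infx.
  apply: sub_finite_set (finite_lev_lt ((lev x).+1 + N)) => y cy /=.
  by rewrite ltnNge; apply/negP => ly; apply: (h y).
pose y := iter (lev y' - ((lev x).+1 + N)) par y'.
have ly : lev y = ((lev x).+1 + N)%N.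
  by rewrite /y (lev_iter_par x0 htree); lia.
rewrite /D -bigcup_seq; exists y.
  by have := mem_sphere x0 htree y; rewrite ly.
split; first by rewrite ly.
move=> z /= /in_vpath[i iN ->]; apply: Ap.
rewrite /y -iterD -lp; apply: walk_meets_ancestor => //.
by rewrite lp iterD -/y (lev_iter_par x0 htree) ly; lia.
Qed.

(** ** An infinite ray *)

(** A ray from the root, following a chosen child at each step. *)
Definition ray (n : nat) : V :=
  iter n (fun x => xget x0 [set y | y \in children x]) x0.

Lemma rayS n : ray n.+1 \in children (ray n).
Proof.
rewrite [ray n.+1]/=; set B := [set y | _].
suff: B (xget x0 B) by [].
by apply: xgetPex; exact: child_exists.
Qed.

Lemma lev_ray n : lev (ray n) = n.
Proof.
elim: n => [|n IH]; first exact: lev_root.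
by have [_ ->] := childP htree (rayS n); rewrite IH.
Qed.

Lemma ray_adj n : E (ray n) (ray n.+1).
Proof. by have := rayS n; rewrite in_children // => /andP[]. Qed.

Lemma ray_component_infinite (A : set V) K :
  (forall k, (K <= k)%N -> A (ray k)) -> ~ all_components_finite E A.
Proof.
move=> hA /(_ (ray K) (hA _ (leqnn K))).
have comp j : graph_component E A (ray K) (ray (K + j)).
  exists [seq ray k | k <- iota K.+1 j].
    elim: j => [|j [hp lp]]; first by rewrite addn0; split.
    rewrite -[j.+1]addn1 iotaD map_cat /=; split.
      by rewrite cat_path hp lp /= andbT; exact: ray_adj.
    by rewrite last_cat /= addn1 addnS.
  move=> z; rewrite inE => /orP[/eqP ->|/mapP[k]]; first exact: hA.
  by rewrite mem_iota => /andP[Kk _] ->; apply: hA; exact: ltnW.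
move=> /(finite_image lev) /finite_seqP[s hs].
pose M := \max_(i <- s) i.
have : [set lev y | y in graph_component E A (ray K)] (K + M.+1)%N.
  by exists (ray (K + M.+1)) => //; exact: lev_ray.
rewrite hs /= => Ms.
have := @leq_bigmax_seq _ _ xpredT id _ Ms isT.
by rewrite -/M; lia.
Qed.

End Percolation.

(** * Vanishing of both thresholds *)

Section Thresholds.
Variables (R : realType) (V : choiceType) (E : rel V) (x0 : V).
Hypothesis htree : is_tree E.
Hypothesis hchildren : forall x, nchildren E x0 x = maxn 1 (gdist E x0 x).
Variables (dX : measure_display) (OX : measurableType dX).
Variables (PX : V -> probability OX R) (X : nat -> OX -> V).
Hypothesis hX : is_srw E PX X.

Section Field.
Variables (d : measure_display) (W : measurableType d) (P : probability W R).
Variable phi : V -> {RV P >-> R}.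
Hypothesis hphi : is_gff (green E PX X) phi.

Lemma gff_pos_level_finite h : 0 < h ->
  \forall w \ae P, all_components_finite E [set x | h <= phi x w].
Proof.
move=> h0.
apply: (@ae_components_finite _ _ _ _ htree hchildren _ _ P
  (fun w => [set x | h <= phi x w]) 1 ((h / 48) ^+ 2)).
- by rewrite exprn_gt0 // divr_gt0.
- by move=> x; exact: measurable_gff_ge.
- move=> y N Ny; have := gff_vpath_ge_le htree hchildren hX hphi (ltW h0) Ny.
  by apply: le_trans.
Qed.

(** Along a ray the probabilities that the field is below [h] are summable, so
   that a far enough part of the ray stays above [h] with probability 1/2. *)
Lemma gff_neg_level_infinite h : h < 0 ->
  ~ (\forall w \ae P, all_components_finite E [set x | h <= phi x w]).
Proof.
move=> h0 [B [mB PB hB]].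
pose c := (h / 20) ^+ 2.
have c0 : 0 < c by rewrite exprn_even_gt0 //= mulf_neq0 // lt_eqF.
have r1 : 0 < 1 - expR (- c) by rewrite subr_gt0 expR_lt1 oppr_lt0.
have [K hK] := exists_nat_gt (2 * (expR 1 / (1 - expR (- c))) / c).
pose F n := [set w | forall k, (k < n)%N -> h <= phi (ray E x0 (K.+1 + k)) w].
have mF n : measurable (F n).
  rewrite (_ : F n = \bigcap_(k in [set k | (k < n)%N])
      [set w | h <= phi (ray E x0 (K.+1 + k)) w]) //.
  by apply: bigcap_measurableType => k _; exact: measurable_gff_ge.
have PF n : (P (~` F n) <=
    (\sum_(k < n) expR ((1 - c * K%:R) - c * k%:R))%:E)%E.
  elim: n => [|n IH].
    rewrite big_ord0 (_ : F 0%N = setT) ?setCT ?measure0 //.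
    by apply/seteqP; split.
  have mn : measurable [set w | h <= phi (ray E x0 (K.+1 + n)) w].
    exact: measurable_gff_ge.
  have -> : ~` F n.+1 = ~` F n `|` ~` [set w | h <= phi (ray E x0 (K.+1 + n)) w].
    rewrite -setCI; congr (~` _); apply/seteqP; split=> w /=.
      move=> Fw; split; last exact: Fw.
      by move=> k kn; apply: Fw; exact: ltnW.
    move=> [Fw Fn] k; rewrite ltnS leq_eqVlt => /orP[/eqP ->//|]; exact: Fw.
  apply: le_trans (measureU2 P _ _) _; [exact: measurableC..|].
  rewrite big_ord_recr EFinD leeD //.
  have rx0 : ray E x0 (K.+1 + n) != x0.
    by rewrite -(lev_gt0 x0 htree) (lev_ray htree hchildren).
  have -> : ~` [set w | h <= phi (ray E x0 (K.+1 + n)) w] =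
            [set w | phi (ray E x0 (K.+1 + n)) w < h].
    by apply/seteqP; split=> w /=; rewrite ltNge => /negP.
  apply: le_trans (gff_lt_le htree hchildren hX hphi h0 rx0) _.
  rewrite lee_fin ler_expR -/c (lev_ray htree hchildren).
  rewrite -addrA lerD2l -opprD lerN2 -mulrDr ler_wpM2l ?(ltW c0) //.
  by rewrite -natrD ler_nat /=; lia.
have half n : ((1 / 2)%:E <= P (F n))%E.
  have := PF n; rewrite probability_setC //.
  rewrite -(fineK (fin_num_measure P _ (mF n))) -EFinB !lee_fin.
  have := sum_expR_le (1 - c * K%:R) n c0.
  suff : expR (1 - c * K%:R) / (1 - expR (- c)) <= 1 / 2 by lra.
  rewrite expRD [expR (- (c * _))]expRN mulrAC ler_pdivrMr ?expR_gt0 //.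
  move: hK; rewrite ltr_pdivrMr // => hK.
  have := expR_ge1Dx (c * K%:R); rewrite mulrC in hK; lra.
have niF : nonincreasing_seq F.
  move=> m n mn; apply/subsetPset => w Fw k km.
  by apply: Fw; exact: leq_trans mn.
have := probability_bigcap_ge mF niF half.
have capB : \bigcap_n F n `<=` B.
  move=> w Fw; apply: hB => /= hw.
  apply: (@ray_component_infinite _ _ _ htree hchildren
    [set x | h <= phi x w] K.+1 _ hw).
  move=> k Kk; have := Fw (k - K)%N I (k - K.+1)%N.
  by rewrite subnKC //; apply; lia.
have mcap : measurable (\bigcap_n F n) by exact: bigcapT_measurable.
have : (P (\bigcap_n F n) <= P B)%E by rewrite le_measure ?inE.
by rewrite PB => /[swap] /le_trans /[apply]; rewrite lee_fin; lra.
Qed.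

Lemma h_star_eq0 : h_star E phi = 0%E.
Proof.
apply/eqP; rewrite eq_le; apply/andP; split.
  apply/lee_addgt0Pr => e e0; rewrite add0e.
  apply: ereal_inf_lbound; exists e => //.
  exact: gff_pos_level_finite.
apply: le_ereal_inf_tmp => _ [h hh <-]; rewrite lee_fin leNgt; apply/negP => h0.
exact: gff_neg_level_infinite h0 hh.
Qed.

End Field.

Section Interlacement.
Variables (d : measure_display) (W : measurableType d) (P : probability W R).
Variable U : R -> W -> set V.
Hypothesis hU : is_vacant_set (cap E PX X) P U.

Lemma vacant_pos_level_finite u : 0 < u ->
  \forall w \ae P, all_components_finite E (U u w).
Proof.
move=> u0.
apply: (@ae_components_finite _ _ _ _ htree hchildren _ _ P (U u) 0 (u / 2)).
- by rewrite divr_gt0.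
- by move=> x; apply: (vacant_measurable hU); exact: ltW.
- move=> y N Ny; rewrite (vacant_law hU _ (ltW u0)).
  have -> : (expR (0 - u / 2 * 'C(N, 2)%:R))%:E =
      expeR (- (u%:E * ('C(N, 2)%:R / 2)%:E))%E.
    by rewrite -EFinM -EFinN /=; congr (expR _)%:E; field.
  rewrite lee_expeR leeN2 lee_wpmul2l ?lee_fin ?(ltW u0) //.
  exact: cap_vpath_ge.
Qed.

Lemma u_star_eq0 : u_star E P U = 0%E.
Proof.
apply/eqP; rewrite eq_le; apply/andP; split.
  apply/lee_addgt0Pr => e e0; rewrite add0e.
  apply: ereal_inf_lbound; exists e => //; split; first exact: ltW.
  exact: vacant_pos_level_finite.
by apply: le_ereal_inf_tmp => _ [u [u0 _] <-]; rewrite lee_fin.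
Qed.

End Interlacement.
End Thresholds.

Theorem mainTheorem6 (R : realType) (V : choiceType) (E : rel V) (x0 : V)
    (htree : is_tree E)
    (hchildren : forall x : V, nchildren E x0 x = maxn 1 (gdist E x0 x))
    (dX : measure_display) (OX : measurableType dX)
    (PX : V -> probability OX R) (X : nat -> OX -> V)
    (hX : is_srw E PX X) :
  transient PX X /\
  forall (dG : measure_display) (OG : measurableType dG)
    (PG : probability OG R) (phi : V -> {RV PG >-> R})
    (hphi : is_gff (green E PX X) phi)
    (dI : measure_display) (OI : measurableType dI)
    (PI : probability OI R) (U : R -> OI -> set V)
    (hU : is_vacant_set (cap E PX X) PI U),
  (0 = h_star E phi /\ h_star E phi = sqrte (2%:E * u_star E PI U))%E.
Proof.
split; first exact: srw_transient hX.
move=> dG OG PG phi hphi dI OI PI U hU.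
rewrite (h_star_eq0 htree hchildren hX hphi) (u_star_eq0 htree hchildren hX hU).
by rewrite mule0 sqrte0.
Qed.
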